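(* Let $\Omega\subset\mathbb{R}^N$ be a bounded domain. Then the embedding $$\widetilde{\mathsf H}(\Delta,\Omega)=\mathsf H(\Delta,\Omega)\cap\mathbb{H}^\perp\hookrightarrow\mathsf L^2(\Omega)$$ is compact.
   Context: A domain is a (nonempty) connected open set $\Omega\subset\mathbb{R}^N$, $N\in\mathbb{N}$; no regularity of the boundary is assumed. $\mathsf H(\Delta,\Omega):=\{\varphi\in\mathsf L^2(\Omega):\Delta\varphi\in\mathsf L^2(\Omega)\}$ (distributional Laplacian) with the graph norm $(\|\varphi\|_{\mathsf L^2}^2+\|\Delta\varphi\|_{\mathsf L^2}^2)^{1/2}$, $\mathbb{H}:=\{\varphi\in\mathsf L^2(\Omega):\Delta\varphi=0\}$, and $\perp$ is orthogonality in $\mathsf L^2(\Omega)$. *)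

(* Defs.v *)
From HB Require Import structures.
From mathcomp Require Import all_boot all_order all_algebra.
From mathcomp Require Import all_classical all_reals all_analysis.
Set Implicit Arguments.
Unset Strict Implicit.
Unset Printing Implicit Defensive.
Import Order.TTheory GRing.Theory Num.Theory.
Import numFieldNormedType.Exports.
Local Open Scope classical_set_scope.
Local Open Scope ring_scope.

Definition measure_rV_display : measure_display -> measure_display.
Proof. exact. Qed.

Section measurable_rV.
Context {R : realType} {N : nat}.

Let coor (i : 'I_N) (x : 'rV[R]_N) : R := x ord0 i.

Let rV_set0 : g_sigma_preimage coor set0.
Proof. exact: sigma_algebra0. Qed.

Let rV_setC A : g_sigma_preimage coor A -> g_sigma_preimage coor (~` A).
Proof. exact: sigma_algebraC. Qed.

Let rV_bigcup (F : _^nat) : (forall i, g_sigma_preimage coor (F i)) ->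
  g_sigma_preimage coor (\bigcup_i (F i)).
Proof. exact: sigma_algebra_bigcup. Qed.

(* Product sigma-algebra on R^N, as the library does for tuples; it is the
   Borel sigma-algebra by [measurable_rVE] below. *)
HB.instance Definition _ := @isMeasurable.Build
  (measure_rV_display default_measure_display)
  'rV[R]_N (g_sigma_preimage coor) rV_set0 rV_setC rV_bigcup.

Lemma measurable_coor (i : 'I_N) :
  measurable_fun [set: 'rV[R]_N] (fun x : 'rV[R]_N => x ord0 i).
Proof.
move=> _ Y mY; rewrite setTI; apply: sub_sigma_algebra => /=.
rewrite -bigcup_seq/=; exists i => /=; first by rewrite mem_index_enum.
by exists Y => //; rewrite setTI.
Qed.

Lemma measurable_fun_rVP d (T : measurableType d) (f : T -> 'rV[R]_N) :
  (forall i, measurable_fun [set: T] (fun t => f t ord0 i)) ->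
  measurable_fun [set: T] f.
Proof.
move=> mf _ A mA; rewrite setTI.
have : g_sigma_preimage (fun i => coor i \o f) `<=` measurable.
  apply: smallest_sub; first exact: sigma_algebra_measurable.
  move=> B; rewrite -bigcup_seq => -[i /= _ [C mC <-]]; exact: mf.
apply; rewrite g_sigma_preimage_comp; exists A => //.
by rewrite setTI.
Qed.

Lemma open_measurable_rV (A : set 'rV[R]_N) : open A -> measurable A.
Proof.
move=> oA.
pose box (c : 'rV[rat]_N * rat) : set 'rV[R]_N :=
  \bigcap_(i in [set: 'I_N])
    ((fun x : 'rV[R]_N => x ord0 i) @^-1` ball (ratr (c.1 ord0 i) : R) (ratr c.2)).
have mbox c : measurable (box c).
  apply: fin_bigcap_measurable => // i _.
  rewrite -[X in measurable X]setTI; apply: measurable_coor => //.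
  rewrite ball_itv; exact: measurable_itv.
have -> : A = \bigcup_(c in [set c | box c `<=` A]) box c.
  apply/seteqP; split => [x Ax|x [c cA]]; last exact: cA.
  have /nbhs_ballP[e /= e0 xeA] : nbhs x A by exact: open_nbhs_nbhs.
  have [q] := rat_in_itvoo (divr_gt0 e0 (@ltr0n R 2)).
  rewrite in_itv/= => /andP[q0 qe].
  have /choice[c cP] i : exists r : rat, ball (x ord0 i) (ratr q) (ratr r : R).
    have : x ord0 i - ratr q < x ord0 i + ratr q by rewrite ltrBlDr -addrA ltrDl addr_gt0.
    move=> /rat_in_itvoo[r]; rewrite in_itv/= => /andP[r1 r2].
    exists r; rewrite /ball/= ltr_distlC r1; exact: r2.
  exists (\row_i c i, q); last first.
    by move=> i _ /=; rewrite mxE; apply: ball_sym; exact: cP.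
  move=> y yb; apply: xeA; split=> // i0 i; rewrite ord1.
  have := yb i I; rewrite /= mxE => yb'.
  rewrite [e]splitr; apply: le_ball (ball_triangle (cP i) yb').
  by rewrite lerD // ltW.
rewrite bigcup_mkcond; apply: countable_bigcupT_measurable => // c.
by case: ifP.
Qed.

Lemma measurable_rVE :
  measurable = <<s (open : set (set 'rV[R]_N)) >> :> set (set 'rV[R]_N).
Proof.
apply/seteqP; split; last first.
  apply: smallest_sub; first exact: sigma_algebra_measurable.
  by move=> A; exact: open_measurable_rV.
apply: smallest_sub; first exact: smallest_sigma_algebra.
move=> A; rewrite -bigcup_seq => -[i /= _ [B mB <-]]; rewrite setTI.
pose F : set (set R) := [set C | <<s open >> (coor i @^-1` C)].
suff : measurable `<=` F by exact.
have -> : (measurable : set (set R)) = <<s @measurable_realfun.RGenOpens.G R >>.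
  exact: measurable_realfun.RGenOpens.measurableE.
apply: smallest_sub.
  split=> [|D|D].
- by rewrite /F/= preimage_set0; exact: sigma_algebra0.
- by rewrite /F/= setTD preimage_setC; exact: sigma_algebraC.
- by move=> mD; rewrite /F/= preimage_bigcup; exact: sigma_algebra_bigcup.
move=> _ [a [b ->]]; apply: sub_sigma_algebra.
by apply: open_comp => [x _|]; [exact: coord_continuous|exact: interval_open].
Qed.

End measurable_rV.

Section lebesgue_rV.
Context {R : realType}.

Definition cons_rV n (x : R * 'rV[R]_n) : 'rV[R]_n.+1 :=
  row_mx (const_mx x.1 : 'rV_1) x.2.

Lemma cons_rV0 n (x : R * 'rV[R]_n) : cons_rV x ord0 ord0 = x.1.
Proof.
have E : lshift n (ord0 : 'I_1) = ord0 by exact: val_inj.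
transitivity (cons_rV x ord0 (lshift n (ord0 : 'I_1))); first by rewrite E.
by rewrite /cons_rV (@row_mxEl R 1 1 n) mxE.
Qed.

Lemma cons_rVS n (x : R * 'rV[R]_n) i : cons_rV x ord0 (lift ord0 i) = x.2 ord0 i.
Proof. by rewrite /cons_rV -rshift1 (@row_mxEr R 1 1 n). Qed.

Lemma measurable_cons_rV n : measurable_fun setT (@cons_rV n).
Proof.
apply: measurable_fun_rVP => i.
have [j ->|->] := unliftP ord0 i; last first.
  by under eq_fun do rewrite cons_rV0; exact: measurable_fst.
under eq_fun do rewrite cons_rVS.
exact: (measurableT_comp (measurable_coor j) measurable_snd).
Qed.

Definition lebesgueS n (m : {sigma_finite_measure set 'rV[R]_n -> \bar R}) :
    set 'rV[R]_n.+1 -> \bar R :=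
  pushforward (@lebesgue_measure R \x m)%E (@cons_rV n).

Section lebesgueS.
Variables (n : nat) (m : {sigma_finite_measure set 'rV[R]_n -> \bar R}).

Let lebesgueS_measure : {measure set 'rV[R]_n.+1 -> \bar R} :=
  measure_function_pushforward__canonical__measure_function_Measure
    (@lebesgue_measure R \x m)%E (@measurable_cons_rV n).

HB.instance Definition _ := isMeasure.Build _ _ _ (lebesgueS m)
  (measure0 lebesgueS_measure) (measure_ge0 lebesgueS_measure)
  (@measure_semi_sigma_additive _ _ _ lebesgueS_measure).

Lemma sigma_finite_lebesgueS : sigma_finite setT (lebesgueS m).
Proof.
pose uncons (x : 'rV[R]_n.+1) : R * 'rV[R]_n :=
  (x ord0 ord0, \row_i x ord0 (lift ord0 i)).
have muncons : measurable_fun setT uncons.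
  apply: measurable_fun_pair; first exact: measurable_coor.
  apply: measurable_fun_rVP => i.
  under eq_fun do rewrite mxE.
  exact: measurable_coor.
have consK : cancel (@cons_rV n) uncons.
  move=> [a v]; rewrite /uncons; congr pair.
    by rewrite (cons_rV0 (a, v)).
  by apply/rowP => i; rewrite mxE cons_rVS.
have /sigma_finiteP[F [TF ndF Foo]] := sigma_finiteT (@lebesgue_measure R).
have /sigma_finiteP[G [TG ndG Goo]] := sigma_finiteT m.
exists (fun k => uncons @^-1` (F k `*` G k)) => [|k].
  apply/esym/seteqP; split => // x _.
  have : setT (uncons x).1 by [].
  have : setT (uncons x).2 by [].
  rewrite TG TF => -[k _ Gk] [l _ Fl]; exists (maxn k l) => //; split.
  - by move: Fl; exact/subsetPset/ndF/leq_maxr.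
  - by move: Gk; exact/subsetPset/ndG/leq_maxl.
have [mF Fy] := Foo k; have [mG Gy] := Goo k.
split.
  by rewrite -[X in measurable X]setTI; apply: muncons => //; exact: measurableX.
rewrite /lebesgueS /pushforward -comp_preimage.
rewrite (_ : uncons \o _ = id); last exact/funext.
by rewrite preimage_id product_measure1E// lte_mul_pinfty// ge0_fin_numE.
Qed.

HB.instance Definition _ := Measure_isSigmaFinite.Build _ _ _ (lebesgueS m)
  sigma_finite_lebesgueS.
End lebesgueS.

(* Lebesgue measure on R^n.+1 is the product of that on R and that on R^n,
   transported by [cons_rV]; it is restricted to Borel sets, which changes
   neither L^2 classes nor integrals. *)
Fixpoint lebesgue_rV n : {sigma_finite_measure set 'rV[R]_n -> \bar R} :=
  if n is n'.+1 then lebesgueS (lebesgue_rV n') else \d_(0 : 'rV[R]_0).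

End lebesgue_rV.

Section test_functions.
Context {R : realType} {N : nat}.
Implicit Types (f psi : 'rV[R]_N -> R) (i : 'I_N) (Omega : set 'rV[R]_N).

Definition partial i f : 'rV[R]_N -> R := 'D_(delta_mx ord0 i) f.

Fixpoint continuously_differentiable (k : nat) f : Prop :=
  continuous f /\
  if k is k'.+1 then
    forall i, (forall x, derivable f x (delta_mx ord0 i)) /\
              continuously_differentiable k' (partial i f)
  else True.

Definition smooth f := forall k, continuously_differentiable k f.

Definition support_of f : set 'rV[R]_N := closure [set x | f x != 0].

(* C_c^oo(Omega), each function being extended by 0 to R^N *)
Definition test_function Omega psi :=
  [/\ smooth psi, compact (support_of psi) & support_of psi `<=` Omega].

Definition classical_laplacian f : 'rV[R]_N -> R :=
  fun x => \sum_(i < N) partial i (partial i f) x.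

End test_functions.

Section L2_laplacian.
Context {R : realType} {N : nat} {Omega : set 'rV[R]_N}.
Variable oOmega : open Omega.
Implicit Types f g h : 'rV[R]_N -> R.

Definition lebesgue_on : {measure set 'rV[R]_N -> \bar R} :=
  mrestr (@lebesgue_rV R N) (open_measurable_rV oOmega).

(* Elements of L^2(Omega) are represented by measurable functions on R^N, whose
   values outside Omega are irrelevant since [lebesgue_on] does not charge the
   complement of Omega; equality in L^2(Omega) is equality [lebesgue_on]-a.e. *)
Definition L2 : set ('rV[R]_N -> R) := [set f | f \in Lfun lebesgue_on 2%:E].

Definition L2_norm f : R := fine ('N[lebesgue_on]_2%:E[EFin \o f])%E.

Definition L2_dot f g : R := \int[lebesgue_on]_x (f x * g x).

Definition is_laplacian f g :=
  forall psi, test_function Omega psi ->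
    L2_dot f (classical_laplacian psi) = L2_dot g psi.

Definition H_laplacian : set ('rV[R]_N -> R) :=
  [set f | L2 f /\ exists g, L2 g /\ is_laplacian f g].

(* For f in H_laplacian, a representative of the distributional Laplacian
   (unique up to equality in L^2(Omega)); the zero function otherwise. *)
Definition laplacian f : 'rV[R]_N -> R :=
  xget (fun=> 0) [set g | L2 g /\ is_laplacian f g].

Definition graph_norm f : R :=
  Num.sqrt (L2_norm f ^+ 2 + L2_norm (laplacian f) ^+ 2).

Definition harmonic : set ('rV[R]_N -> R) :=
  [set f | L2 f /\ is_laplacian f (fun=> 0)].

Definition L2_orthogonal (A : set ('rV[R]_N -> R)) : set ('rV[R]_N -> R) :=
  [set f | L2 f /\ forall h, A h -> L2_dot f h = 0].

Definition H_laplacian_tilde : set ('rV[R]_N -> R) :=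
  H_laplacian `&` L2_orthogonal harmonic.

End L2_laplacian.

(* The inclusion of (E, normE) into (F, normF) is a compact operator: it sends
   bounded sequences to sequences having a convergent subsequence. *)
Definition compact_embedding (R : realType) (V : zmodType)
    (E : set V) (normE : V -> R) (F : set V) (normF : V -> R) :=
  E `<=` F /\
  forall u : nat -> V, (forall n, E (u n)) ->
    (exists M : R, forall n, normE (u n) <= M) ->
    exists s : nat -> nat, {homo s : m n / (m < n)%N} /\
      exists2 l, F l & (fun n => normF (u (s n) - l)) @ \oo --> (0 : R).

(* Main.v *)
(* The images Delta psi of the test functions are dense in harmonic^perp, since a
   vector of L^2 orthogonal to all of them is harmonic. Hence a sequence u_k in
   H~(Delta, Omega) is approximated in L^2, up to errors r_k -> 0, by Delta psi_k
   with psi_k test functions. The identity |grad psi|^2 = - <psi, Delta psi> and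
   the Poincare inequality bound psi_k in H^1 by Delta psi_k, and Rellich's theorem
   makes psi_k Cauchy in L^2 along any ultrafilter. Finally, by duality,
     |u_k - u_l|^2 = <u_k - u_l, r_k - r_l> + <Delta u_k - Delta u_l, psi_k - psi_l>,
   so u_k is Cauchy along the same ultrafilter, from which a subsequence is
   extracted. Rellich's theorem comes from an Ehrling inequality on a cube: up to
   a small multiple of the Dirichlet integral, finitely many linear functionals
   control the L^2 norm. *)
Require Import Defs.
From mathcomp Require Import all_boot all_order all_algebra.
From mathcomp Require Import all_classical all_reals all_analysis.
From mathcomp Require Import measurable_realfun lra ring.
Import Order.TTheory GRing.Theory Num.Theory.
Import numFieldNormedType.Exports.
Set Implicit Arguments.
Unset Strict Implicit.
Unset Printing Implicit Defensive.
Local Open Scope classical_set_scope.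
Local Open Scope ring_scope.

(** * Projection in an inner product space *)

(** Since nothing is known about the boundary of Omega, no H^1 bound up to the boundary is available
    for the u_k, and they cannot be integrated by parts. The derivatives that Rellich's theorem
    needs are therefore taken of test functions only: extended by zero, these vanish on the faces of
    a cube containing Omega, and all the calculus takes place on that cube, one variable at a time.
    The duality identity uses Delta u only through its definition, with psi_k - psi_l as test
    function. Plain density is enough: an error 1/(k+1) is prescribed for the squared distance, and
    the bound on Delta psi_k then follows from that on u_k. Along an ultrafilter every bounded real
    sequence is Cauchy, so finitely many functionals are handled by intersecting finitely many sets,
    and a subsequence is extracted only once, at the end. The Poincare inequality needs a direction,
    hence positive dimension; dimension 0 is treated apart. *)

Lemma sqr_le_of_quadratic_ge0 (R : realFieldType) (a b c : R) : 0 <= c ->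
  (forall t, 0 <= a - t * (2 * b) + t ^+ 2 * c) -> b ^+ 2 <= a * c.
Proof.
move=> c0 H; have [c00|cn] := eqVneq c 0.
  have [b0|bn] := eqVneq b 0; first by rewrite b0 c00; lra.
  (* For c = 0 the form is affine in t, and at this t it equals -1. *)
  have := H ((a + 1) / (2 * b)).
  have -> : (a + 1) / (2 * b) * (2 * b) = a + 1 by rewrite divfK// mulf_neq0// pnatr_eq0.
  by rewrite c00; lra.
have {c0 cn} c0 : 0 < c by rewrite lt_def cn c0.
have := H (b / c).
have -> : a - b / c * (2 * b) + (b / c) ^+ 2 * c = (a * c - b ^+ 2) / c by field; lra.
by rewrite pmulr_lge0 ?invr_gt0//; lra.
Qed.

Section prehilbert.
Context {R : realType} {V : lmodType R}.
(** Linearity of [dot] is required on [L] only, because integrals are additive only on integrable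
    functions; [dot] is merely semidefinite, because functions are not identified almost
    everywhere. *)
Variables (L : set V) (dot : V -> V -> R).
Hypotheses (L0 : L 0) (LP : forall a u v, L u -> L v -> L (a *: u + v)).
Hypothesis dotC : forall u v, dot u v = dot v u.
Hypothesis dotP : forall a u v w, L u -> L v -> L w ->
  dot (a *: u + v) w = a * dot u w + dot v w.
Hypothesis dot_ge0 : forall u, 0 <= dot u u.

Let LB u v : L u -> L v -> L (u - v).
Proof. by move=> Lu Lv; rewrite addrC -scaleN1r; exact: LP. Qed.

Let dotB u v w : L u -> L v -> L w -> dot (u - v) w = dot u w - dot v w.
Proof.
by move=> *; rewrite addrC -scaleN1r dotP// mulN1r addrC.
Qed.

Lemma dot_lincomb a u v : L u -> L v ->
  dot (a *: u + v) (a *: u + v) = a ^+ 2 * dot u u + a * (2 * dot u v) + dot v v.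
Proof.
move=> Lu Lv; have Luv := LP a Lu Lv.
rewrite dotP// ![dot _ (_ + _)]dotC !dotP// (dotC v u); ring.
Qed.

Lemma cauchy_schwarz u v : L u -> L v -> dot u v ^+ 2 <= dot u u * dot v v.
Proof.
move=> Lu Lv; rewrite mulrC; apply: sqr_le_of_quadratic_ge0 => // t.
have := dot_ge0 ((- t) *: u + v); rewrite dot_lincomb//.
by rewrite sqrrN mulNr; congr (_ <= _); ring.
Qed.

Lemma dot_sqrB u v : L u -> L v ->
  dot (u - v) (u - v) = dot u u - 2 * dot u v + dot v v.
Proof.
move=> Lu Lv; rewrite addrC -scaleN1r dot_lincomb// (dotC v u); ring.
Qed.

(** The parallelogram identity without the term of u + v. It stands in for the triangle inequality,
    so that distances can be kept squared. *)
Lemma dot_sqrB_le u v : L u -> L v ->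
  dot (u - v) (u - v) <= 2 * dot u u + 2 * dot v v.
Proof.
move=> Lu Lv; rewrite dot_sqrB//.
have := dot_ge0 (1 *: u + v); rewrite dot_lincomb//; lra.
Qed.

Lemma dot_triangle u v w : L u -> L v -> L w ->
  dot (u - w) (u - w) <= 2 * dot (u - v) (u - v) + 2 * dot (w - v) (w - v).
Proof.
move=> Lu Lv Lw; have -> : u - w = (u - v) - (w - v).
  by rewrite opprB addrA subrK.
by apply: dot_sqrB_le; exact: LB.
Qed.

Hypothesis complete : forall u : nat -> V, (forall n, L (u n)) ->
  (forall e, 0 < e -> exists N, forall m n, (N <= m)%N -> (N <= n)%N ->
     dot (u m - u n) (u m - u n) <= e) ->
  exists2 l, L l & forall e, 0 < e -> exists N, forall n, (N <= n)%N ->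
     dot (u n - l) (u n - l) <= e.

(* A sequence in W minimizing the distance to p is Cauchy, and the difference of p
   with its limit is orthogonal to W. *)
Lemma approx_of_bi_orthogonal (W : set V) (p : V) : W `<=` L -> W 0 ->
  (forall a u v, W u -> W v -> W (a *: u + v)) -> L p ->
  (forall h, L h -> (forall w, W w -> dot h w = 0) -> dot p h = 0) ->
  forall e, 0 < e -> exists2 w, W w & dot (p - w) (p - w) <= e.
Proof.
move=> WL W0 WP Lp Hp e e0.
pose A := [set dot (p - w) (p - w) | w in W].
have infA : has_inf A.
  by split; [exists (dot (p - 0) (p - 0)), 0|exists 0 => _ [w _ <-]].
have dle w : W w -> inf A <= dot (p - w) (p - w).
  by move=> Ww; apply: ge_inf; [exact: infA.2|exists w].
have inv0 n : 0 < (n.+1%:R^-1 : R) by rewrite invr_gt0 ltr0n.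
have invS (x : R) : 0 < x -> exists N, forall n, (N <= n)%N -> n.+1%:R^-1 <= x.
  move=> x0; have [N _ HN] := near_infty_natSinv_lt (PosNum x0).
  by exists N => n /HN /ltW.
have /choice[u uP] n : exists w, W w /\ dot (p - w) (p - w) < inf A + n.+1%:R^-1.
  have [_ [w Ww <-] wlt] := inf_adherent (inv0 n) infA.
  by exists w.
have Lu n : L (u n) by apply: WL; case: (uP n).
have upar m n : dot (u m - u n) (u m - u n) <= 2 * m.+1%:R^-1 + 2 * n.+1%:R^-1.
  have [Wm dm] := uP m; have [Wn dn] := uP n.
  (* The midpoint of u m and u n, with a final + 0 to fit the shape of [WP]. Its squared distance to
     p is at least the infimum, which by the parallelogram identity forces u m and u n together. *)
  have Wmn : W (2^-1 *: u m + (2^-1 *: u n + 0)) by apply: (WP _ _ _ Wm); exact: (WP _ _ _ Wn W0).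
  have := dle _ Wmn.
  have -> : p - (2^-1 *: u m + (2^-1 *: u n + 0)) =
      2^-1 *: (p - u m) + (2^-1 *: (p - u n) + 0).
    rewrite !addr0 !scalerBr addrACA -scalerDl -opprD.
    have -> : 2^-1 + 2^-1 = 1 :> R by lra.
    by rewrite scale1r.
  have -> : u m - u n = (p - u n) - (p - u m) by rewrite opprB [RHS]addrC addrA subrK.
  have Lm := LB Lp (Lu m); have Ln := LB Lp (Lu n).
  move: (LB Lp (Lu m)) (LB Lp (Lu n)) dm dn.
  move: (p - u m) (p - u n) => a b La Lb dm dn.
  have dot0 v : L v -> dot 0 v = 0.
    by move=> Lv; have := dotP 1 L0 L0 Lv; rewrite scaler0 addr0; lra.
  have Lb2 : L (2^-1 *: b + 0) by exact: LP.
  rewrite dot_sqrB// dot_lincomb// dot_lincomb// (dotC a) dotP// (dotC b 0) !dot0//.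
  by rewrite (dotC b a); move: (m.+1%:R^-1) (n.+1%:R^-1) dm dn => x y; lra.
have [l Ll ul] : exists2 l, L l & forall e, 0 < e -> exists N, forall n,
    (N <= n)%N -> dot (u n - l) (u n - l) <= e.
  apply: complete => // d d0; have [|N HN] := invS (d / 4); first by lra.
  exists N => m n Nm Nn; have := upar m n.
  by move: (HN _ Nm) (HN _ Nn); move: (m.+1%:R^-1) (n.+1%:R^-1) => x y; lra.
have Lpl := LB Lp Ll.
(* W need not be closed, so l need not lie in it: <p - l, w> is split into <p - u n, w>, small
   because u n is nearly minimizing, and <u n - l, w>, small by convergence. *)
have orth w : W w -> dot (p - l) w = 0.
  move=> Ww; apply/eqP; rewrite -sqrf_eq0 eq_le sqr_ge0 andbT.
  apply/ler_addgt0Pl => d d0; rewrite addr0.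
  pose c := dot w w; have c0 : 0 <= c by exact: dot_ge0.
  have dc : 0 < d / (4 * (c + 1)) by rewrite divr_gt0//; lra.
  have [N1 HN1] := invS _ dc; have [N2 HN2] := ul _ dc.
  pose n := maxn N1 N2; have [Wn dn] := uP n.
  have Lw := WL _ Ww; have Lpn := LB Lp (Lu n); have Lnl := LB (Lu n) Ll.
  (* Moving u n by t w cannot lower the squared distance to p by more than 1/(n+1), which gives a
     quadratic in t that stays nonnegative. *)
  have h1 : dot (p - u n) w ^+ 2 <= n.+1%:R^-1 * c.
    apply: sqr_le_of_quadratic_ge0 => // t.
    have := dle _ (WP t w (u n) Ww Wn).
    have -> : p - (t *: w + u n) = (- t) *: w + (p - u n).
      by rewrite opprD addrA addrAC scaleNr addrC.
    rewrite dot_lincomb// (dotC w) sqrrN -/c.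
    move: (dn); move: (n.+1%:R^-1) (dot (p - u n) (p - u n)) (dot (p - u n) w).
    by move=> x y z; lra.
  have h2 := cauchy_schwarz Lnl Lw; rewrite -/c in h2.
  have -> : dot (p - l) w = dot (p - u n) w + dot (u n - l) w.
    by rewrite !dotB//; ring.
  have h3 := HN1 _ (leq_maxl N1 N2); have h4 := HN2 _ (leq_maxr N1 N2).
  rewrite -/n in h3 h4.
  move: (n.+1%:R^-1) h1 h3 {dn} => q h1 h3.
  have h5 : q * c <= d / (4 * (c + 1)) * c by exact: ler_wpM2r.
  have h6 : dot (u n - l) (u n - l) * c <= d / (4 * (c + 1)) * c by exact: ler_wpM2r.
  have h7 : d / (4 * (c + 1)) * c <= d / 4.
    have -> : d / (4 * (c + 1)) * c = d / 4 * (c / (c + 1)) by field; lra.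
    rewrite ler_piMr//; first by lra.
    rewrite ler_pdivrMr; lra.
  have := sqr_ge0 (dot (p - u n) w - dot (u n - l) w).
  set x := dot (p - u n) w in h1 *; set y := dot (u n - l) w in h2 *.
  have -> : (x + y) ^+ 2 = 2 * x ^+ 2 + 2 * y ^+ 2 - (x - y) ^+ 2 by ring.
  lra.
(* This is where bi-orthogonality enters: p - l is orthogonal to W, hence to p. It is also
   orthogonal to l, a limit of elements of W, so its norm is 0. *)
have pl0 : dot p (p - l) = 0 by apply: Hp.
have ll0 : dot l (p - l) = 0.
  apply/eqP; rewrite -sqrf_eq0 eq_le sqr_ge0 andbT.
  apply/ler_addgt0Pl => d d0; rewrite addr0.
  pose c := dot (p - l) (p - l); have c0 : 0 <= c by exact: dot_ge0.
  have dc : 0 < d / (c + 1) by rewrite divr_gt0//; lra.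
  have [N HN] := ul _ dc.
  have Lnl := LB (Lu N) Ll.
  have -> : dot l (p - l) = - dot (u N - l) (p - l).
    by rewrite dotB// (dotC (u N)) orth ?sub0r ?opprK//; case: (uP N).
  rewrite sqrrN; apply: le_trans (cauchy_schwarz Lnl Lpl) _; rewrite -/c.
  apply: le_trans (ler_wpM2r c0 (HN N (leqnn _))) _.
  by rewrite mulrAC ler_pdivrMr ?ler_wpM2l; lra.
have [|N HN] := ul (e / 2); first by lra.
exists (u N); first by case: (uP N).
have := dot_triangle Lp Ll (Lu N).
have := HN N (leqnn _).
have -> : dot (p - l) (p - l) = 0 by rewrite dotB// pl0 ll0 subrr.
lra.
Qed.

End prehilbert.

(** * Square integrable functions *)

Section square_integrable.
Context {d} {T : measurableType d} {R : realType}.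
Variables (mu : {measure set T -> \bar R}) (D : set T).
Hypothesis mD : measurable D.
Implicit Types f g h : T -> R.

(** Having both a measure and a domain as parameters lets the same lemmas serve Omega, whose measure
    is already restricted (D = setT), and segments and cubes under Lebesgue measure. *)
Definition sqint : set (T -> R) := [set f : T -> R | measurable_fun setT f /\
  mu.-integrable D (EFin \o (fun x => f x ^+ 2))].

Definition inner f g : R := \int[mu]_(x in D) (f x * g x).

Lemma sqint_mul f g : sqint f -> sqint g ->
  mu.-integrable D (EFin \o (fun x => f x * g x)).
Proof.
move=> [mf If] [mg Ig].
apply: (@le_integrable _ _ _ mu _ mD _ (EFin \o (fun x => f x ^+ 2 + g x ^+ 2))).
- apply/measurable_EFinP; apply: measurable_funTS; exact: measurable_funM.
- move=> x Dx /=; rewrite lee_fin normrM [leRHS]ger0_norm ?addr_ge0 ?sqr_ge0//.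
  rewrite -[f x ^+ 2]real_normK ?num_real// -[g x ^+ 2]real_normK ?num_real//.
  have := normr_ge0 (f x); have := normr_ge0 (g x).
  by move: `|f x| `|g x| => a b a0 b0; have := sqr_ge0 (a - b); nra.
- rewrite (_ : _ \o _ = ((EFin \o (fun x => f x ^+ 2)%R) \+ (EFin \o (fun x => g x ^+ 2)%R))%E) //.
  exact: integrableD.
Qed.

Lemma sqint0 : sqint 0.
Proof.
split; first exact: measurable_cst.
rewrite (_ : _ \o _ = cst 0%E); first exact: integrable0.
by apply/funext => x /=; rewrite expr0n.
Qed.

Lemma sqintP a f g : sqint f -> sqint g -> sqint (a *: f + g).
Proof.
move=> Lf Lg; have [mf If] := Lf; have [mg Ig] := Lg; split.
  by apply: measurable_funD => //; apply: measurable_funM.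
rewrite (_ : _ \o _ = (fun x => (a ^+ 2)%:E * (f x ^+ 2)%:E) \+
  ((fun x => (2 * a)%:E * (f x * g x)%:E) \+ (EFin \o (fun x => g x ^+ 2)%R)))%E.
  apply: integrableD => //; first exact: integrableZl.
  by apply: integrableD => //; apply: integrableZl => //; exact: sqint_mul.
apply/funext => x /=; rewrite -!EFinM -!EFinD; congr EFin.
rewrite (_ : (a *: f + g) x = a * f x + g x)//. ring.
Qed.

Lemma innerC f g : inner f g = inner g f.
Proof. by apply: eq_Rintegral => x _; rewrite mulrC. Qed.

Lemma innerP a f g h : sqint f -> sqint g -> sqint h ->
  inner (a *: f + g) h = a * inner f h + inner g h.
Proof.
move=> Lf Lg Lh; rewrite /inner.
rewrite -RintegralZl//; last exact: sqint_mul.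
rewrite -RintegralD//; last 2 first.
- rewrite (_ : _ \o _ = (fun x => a%:E * (f x * h x)%:E)%E)//.
  by apply: integrableZl => //; exact: sqint_mul.
- exact: sqint_mul.
apply: eq_Rintegral => x _.
rewrite (_ : (a *: f + g) x = a * f x + g x)//. ring.
Qed.

Lemma inner_ge0 f : 0 <= inner f f.
Proof. by apply: Rintegral_ge0 => x _; rewrite -expr2 sqr_ge0. Qed.

Lemma inner_normE f : sqint f ->
  (inner f f)%:E = (\int[mu]_(x in D) (f x ^+ 2)%:E)%E.
Proof.
move=> Lf; rewrite /inner /Rintegral fineK.
  by apply: eq_integral => x _; rewrite expr2.
by apply: integrable_fin_num => //; exact: sqint_mul.
Qed.

(** The working class of integrands: stable under the algebraic operations and integrable over
    measurable sets of finite measure, so that computations on a cube carry no separate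
    integrability conditions. *)
Definition bounded_measurable f :=
  measurable_fun setT f /\ exists M, forall x, `|f x| <= M.

Lemma bounded_measurableD f g : bounded_measurable f -> bounded_measurable g ->
  bounded_measurable (fun x => f x + g x).
Proof.
move=> [mf [M Mf]] [mg [K Kg]]; split; first exact: measurable_funD.
by exists (M + K) => x; apply: le_trans (ler_normD _ _) _; exact: lerD.
Qed.

Lemma bounded_measurableM f g : bounded_measurable f -> bounded_measurable g ->
  bounded_measurable (fun x => f x * g x).
Proof.
move=> [mf [M Mf]] [mg [K Kg]]; split; first exact: measurable_funM.
by exists (M * K) => x; rewrite normrM; exact: ler_pM.
Qed.

Lemma bounded_measurable_cst a : bounded_measurable (fun=> a).
Proof. by split; [exact: measurable_cst|exists `|a|]. Qed.

Lemma bounded_measurableZ a f : bounded_measurable f ->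
  bounded_measurable (fun x => a * f x).
Proof. by apply: bounded_measurableM; exact: bounded_measurable_cst. Qed.

Lemma bounded_measurableN f : bounded_measurable f ->
  bounded_measurable (fun x => - f x).
Proof.
move=> /(bounded_measurableZ (-1)).
by rewrite (_ : (fun x => -1 * f x) = (fun x => - f x))//; apply/funext => x; rewrite mulN1r.
Qed.

Lemma bounded_measurableB f g : bounded_measurable f -> bounded_measurable g ->
  bounded_measurable (fun x => f x - g x).
Proof. by move=> bf /bounded_measurableN; exact: bounded_measurableD. Qed.

Lemma bounded_measurableX f : bounded_measurable f ->
  bounded_measurable (fun x => f x ^+ 2).
Proof. by move=> bf; exact: bounded_measurableM. Qed.

Hypothesis fD : (mu D < +oo)%E.

Lemma bounded_measurable_integrable f : bounded_measurable f ->
  mu.-integrable D (EFin \o f).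
Proof.
move=> [mf [M Mf]]; apply: measurable_bounded_integrable => //.
  exact: measurable_funTS.
exists M; split; first exact: num_real.
by move=> y My x Dx; apply: (le_trans (Mf x)); exact: ltW.
Qed.

Lemma bounded_measurable_sqint f : bounded_measurable f -> sqint f.
Proof.
move=> bf; split; first by case: bf.
by apply: bounded_measurable_integrable; exact: bounded_measurableX.
Qed.

End square_integrable.

(** * Completeness of L^2 over a finite measure space *)

Lemma L1_le_L2 {d} {T : measurableType d} {R : realType}
    (mu : {measure set T -> \bar R}) f : (mu setT < +oo)%E -> sqint mu setT f ->
  (\int[mu]_x `|f x|%:E <=
    (Num.sqrt (fine (mu setT) * inner mu setT f f))%:E)%E.
Proof.
move=> fmu Lf; have [mf _] := Lf.
pose g x := `|f x|.
have Lg : sqint mu setT g.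
  split; first exact: measurableT_comp.
  have [_ ] := Lf; congr (_.-integrable _ _).
  by apply/funext => x /=; rewrite real_normK ?num_real.
have L1 : sqint mu setT (cst 1).
  by apply: bounded_measurable_sqint => //; exact: bounded_measurable_cst.
have I1 := sqint_mul measurableT Lg L1.
have -> : (\int[mu]_x `|f x|%:E = (inner mu setT g (cst 1))%:E)%E.
  rewrite /inner /Rintegral fineK; last by exact: integrable_fin_num.
  by apply: eq_integral => x _; rewrite mulr1.
rewrite lee_fin -[leLHS]ger0_norm; last first.
  by apply: Rintegral_ge0 => x _; rewrite mulr1 /g.
rewrite -sqrtr_sqr ler_wsqrtr//.
have := @cauchy_schwarz _ _ (sqint mu setT) (inner mu setT)
  (fun a u v => @sqintP _ _ _ mu setT measurableT a u v)
  (innerC mu setT) (fun a u v w => @innerP _ _ _ mu setT measurableT a u v w)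
  (inner_ge0 mu setT) _ _ Lg L1.
rewrite mulrC; congr (_ <= _ * _).
  rewrite /inner (@eq_Rintegral _ _ _ _ _ (cst 1)); last by move=> x _ /=; rewrite mulr1.
  by rewrite Rintegral_cst// mul1r.
by apply: eq_Rintegral => x _; rewrite -!expr2 /g real_normK ?num_real.
Qed.

Lemma cvgn_of_summable_increments (R : realType) (v : R ^nat) :
  (\sum_(0 <= k <oo) `|v k.+1 - v k|%:E < +oo)%E -> cvgn v.
Proof.
move=> foo; have : cvgn (series (telescope v)).
  apply: normed_cvg; apply: nondecreasing_is_cvgn.
    by apply: nondecreasing_series => k _ _; exact: normr_ge0.
  exists (fine (\sum_(0 <= k <oo) `|v k.+1 - v k|%:E)%E) => _ [n _ <-].
  rewrite -lee_fin fineK; last first.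
    by rewrite ge0_fin_numE//; apply: nneseries_ge0 => k _ _; rewrite lee_fin.
  rewrite -[X in X%:E]/(\sum_(0 <= k < n) `|v k.+1 - v k|) -sumEFin.
  apply: nneseries_lim_ge => k _ _.
  by rewrite lee_fin.
move=> cv; rewrite (_ : v = cst (v 0%N) + series (telescope v)).
  by apply: is_cvgD => //; exact: is_cvg_cst.
by apply/funext => n; rewrite [LHS]eq_sum_telescope.
Qed.

Section L2_complete.
Context {d} {T : measurableType d} {R : realType}.
Variable mu : {measure set T -> \bar R}.
Hypothesis fmu : (mu setT < +oo)%E.
Implicit Types u v : nat -> T -> R.

Local Notation sqint := (sqint mu setT).
Local Notation inner := (inner mu setT).

Let sqintB f g : sqint f -> sqint g -> sqint (f - g).
Proof.
by move=> Lf Lg; rewrite addrC -scaleN1r; exact: sqintP.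
Qed.

(* On a finite measure space, L^2 bounds on the increments are L^1 bounds, so the
   series of the increments converges absolutely almost everywhere. *)
Lemma cvg_ae_of_geometric v (C : R) : (forall k, sqint (v k)) ->
  (forall k, inner (v k.+1 - v k) (v k.+1 - v k) <= (C / (2 ^ k.+1)%:R) ^+ 2) ->
  exists E, [/\ measurable E, mu (~` E) = 0 &
    forall x, E x -> cvgn (fun k => v k x)].
Proof.
move=> Lv gv.
wlog C0 : C gv / 0 <= C.
  move=> /(_ `|C|); apply => // k.
  by apply: le_trans (gv k) _; rewrite !exprMn real_normK ?num_real.
pose F k x := (`|v k.+1 x - v k x|%:E : \bar R).
have Ldv k : sqint (v k.+1 - v k) by exact: sqintB.
have mF k : measurable_fun setT (F k).
  by apply/measurable_EFinP; apply: measurableT_comp => //; case: (Ldv k).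
(* [G] is the total variation of the sequence at x. Its integral is finite by summing the bounds C /
   2^(k+1), so [G] itself is finite almost everywhere. *)
pose G x := (\sum_(0 <= k <oo) F k x)%E.
have mG : measurable_fun setT G.
  by apply: (@ge0_emeasurable_sum _ _ _ _ F xpredT) => // k x _ _; rewrite lee_fin.
have G0 x : (0 <= G x)%E by apply: nneseries_ge0 => k _ _; rewrite lee_fin.
have IG : mu.-integrable setT G.
  apply/integrableP; split => //.
  under eq_integral do rewrite gee0_abs//.
  rewrite integral_nneseries//; last by move=> k x _; rewrite lee_fin.
  pose c := Num.sqrt (fine (mu setT)).
  apply: (@le_lt_trans _ _ (c * C)%:E); last exact: ltry.
  apply: le_trans (epsilon_trick0 xpredT (mulr_ge0 (sqrtr_ge0 _) C0)).
  apply: lee_nneseries => k _.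
    by move=> _; apply: integral_ge0 => x _; rewrite lee_fin.
  apply: le_trans (L1_le_L2 fmu (Ldv k)) _; rewrite lee_fin.
  rewrite sqrtrM ?fine_ge0// -mulrA ler_wpM2l ?sqrtr_ge0//.
  rewrite -[leRHS]ger0_norm ?divr_ge0// -sqrtr_sqr ler_wsqrtr//.
exists (setT `&` [set x | (G x < +oo)%E]); split.
- exact: emeasurable_fun_infty_o.
- have [N [mN N0 sN]] := integrable_ae measurableT IG.
  apply: (@subset_measure0 _ _ _ mu _ N) => //.
    by apply: measurableC; exact: emeasurable_fun_infty_o.
  move=> x; rewrite setTI => xE; apply: sN => /(_ I) fx; apply: xE => /=.
  by rewrite -ge0_fin_numE.
- by move=> x [_ Gx]; exact: cvgn_of_summable_increments.
Qed.

(** Riesz-Fischer: a subsequence with geometrically small increments converges almost everywhere,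
    and Fatou's lemma makes its pointwise limit an L^2 limit of the whole sequence. *)
Lemma L2_complete u : (forall n, sqint (u n)) ->
  (forall e, 0 < e -> exists N, forall m n, (N <= m)%N -> (N <= n)%N ->
     inner (u m - u n) (u m - u n) <= e) ->
  exists2 l, sqint l & forall e, 0 < e -> exists N, forall n, (N <= n)%N ->
     inner (u n - l) (u n - l) <= e.
Proof.
move=> Lu cu.
have /choice[N NP] k : exists N, forall m n, (N <= m)%N -> (N <= n)%N ->
    inner (u m - u n) (u m - u n) <= (1 / (2 ^ k.+1)%:R) ^+ 2.
  by apply: cu; rewrite exprn_gt0// divr_gt0// ltr0n expn_gt0.
(* Summing the N j puts both [nk k] and [nk k.+1] above N k without monotonicity of N; adding k
   gives indices that tend to infinity. *)
pose nk k := (\sum_(j < k.+1) N j + k)%N.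
have leN k : (N k <= nk k)%N.
  by rewrite /nk big_ord_recr/= addnAC leq_addl.
have leN1 k : (N k <= nk k.+1)%N.
  by rewrite /nk 2!big_ord_recr/= -!addnA addnCA leq_addr.
have lek k : (k <= nk k)%N by rewrite leq_addl.
pose v k := u (nk k).
have Lv k : sqint (v k) by exact: Lu.
have gv k : inner (v k.+1 - v k) (v k.+1 - v k) <= (1 / (2 ^ k.+1)%:R) ^+ 2.
  exact: NP.
have [E [mE E0 cE]] := cvg_ae_of_geometric Lv gv.
(* With the value 0 off E, l is an everywhere limit of measurable functions. *)
pose l : T -> R := (fun x => limn (fun k => v k x)) \_ E.
have vl x : E x -> (fun k => v k x) @ \oo --> l x.
  by move=> Ex; rewrite /l patchE mem_set//; exact: cE.
have ml : measurable_fun setT l.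
  apply: (@measurable_fun_cvg _ _ _ _ (fun k => v k \_ E)) => [k|x _].
    apply/(measurable_restrictT _ mE).1/measurable_funTS.
    by case: (Lv k).
  have [Ex|nEx] := pselect (E x).
    by apply: cvg_trans (vl _ Ex); apply: near_eq_cvg; near=> k; rewrite patchE mem_set.
  rewrite /l patchE memNset//.
  rewrite (_ : (fun k => _) = cst 0); first exact: cvg_cst.
  by apply/funext => k /=; rewrite patchE memNset.
(* Fatou along v carries a Cauchy bound over to the limit. It serves twice: for l being square
   integrable and for the convergence. *)
have fatou_le n M e : (forall m, (M <= m)%N -> inner (u n - u m) (u n - u m) <= e) ->
    (\int[mu]_x ((u n x - l x) ^+ 2)%:E <= e%:E)%E.
  move=> He.
  have mun : measurable_fun setT (fun x => ((u n x - l x) ^+ 2)%:E : \bar R).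
    apply/measurable_EFinP; apply: measurable_funX; apply: measurable_funB => //.
    by case: (Lu n).
  have -> : (\int[mu]_x ((u n x - l x) ^+ 2)%:E =
             \int[mu]_(x in E) ((u n x - l x) ^+ 2)%:E)%E.
    rewrite (@ge0_negligible_integral _ _ _ mu setT (~` E))//.
    - by rewrite setTD setCK.
    - exact: measurableC.
    - by move=> x _; rewrite lee_fin sqr_ge0.
  pose f k x := (((u n x - v k x) ^+ 2)%:E : \bar R).
  have -> : (\int[mu]_(x in E) ((u n x - l x) ^+ 2)%:E =
      \int[mu]_(x in E) limn_einf (f^~ x))%E.
    apply: eq_integral => x; rewrite inE => Ex; apply/esym.
    apply: (cvg_limn_einf_sup _).1; apply: cvg_EFin; first exact: nearW.
    rewrite (_ : _ \o _ = fun k => (u n x - v k x) ^+ 2)//.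
    have -> : (fun k => (u n x - v k x) ^+ 2) = (fun k => (u n x - v k x) * (u n x - v k x)).
      by apply/funext => k; rewrite expr2.
    by rewrite expr2; apply: cvgM; (apply: cvgB; [exact: cvg_cst|exact: vl]).
  have mf k : measurable_fun setT (f k).
    apply/measurable_EFinP; apply: measurable_funX; apply: measurable_funB.
      by case: (Lu n).
    by case: (Lv k).
  apply: le_trans (fatou mu mE _ _) _ => //.
  - by move=> k; exact: measurable_funTS.
  - by move=> k x _; rewrite lee_fin sqr_ge0.
  rewrite limn_einf_lim; apply: lime_le; first exact: is_cvg_einfs.
  exists M => // k Mk /=.
  apply: le_trans (ereal_inf_lbound _) _; first by exists k => //=.
  apply: (@le_trans _ _ (\int[mu]_x f k x)%E).
    by apply: ge0_subset_integral => // x _; rewrite lee_fin sqr_ge0.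
  have := He (nk k) (leq_trans Mk (lek k)).
  by rewrite -lee_fin inner_normE//; exact: sqintB.
have Ll : sqint l.
  have [|M HM] := cu 1; first by [].
  have H := fatou_le M M 1 (fun m Mm => HM _ _ (leqnn M) Mm).
  have Lul : sqint (u M - l).
    split; first by apply: measurable_funB => //; case: (Lu M).
    apply/integrableP; split.
      apply/measurable_EFinP; apply: measurable_funX; apply: measurable_funB => //.
      by case: (Lu M).
    under eq_integral do rewrite gee0_abs ?lee_fin ?sqr_ge0//.
    by apply: le_lt_trans H _; exact: ltry.
  have -> : l = u M - (u M - l) by rewrite opprB addrC subrK.
  exact: sqintB.
exists l => // e e0; have [M HM] := cu _ e0; exists M => n Mn.
rewrite -lee_fin inner_normE; last exact: sqintB.
by apply: (fatou_le n M) => m Mm; exact: HM.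
Unshelve. all: by end_near.
Qed.

End L2_complete.

(** * Integration over a cube of R^n *)

Section cube_integral.
Context {R : realType}.
Variable B : R.

Local Notation leb := (@lebesgue_measure R).
Local Notation J := `[(- B)%R, B]%classic.

Definition cube n : set 'rV[R]_n := [set x | forall i, x ord0 i \in `[- B, B]].

Lemma itv_fin : (leb J < +oo)%E.
Proof. by rewrite lebesgue_measure_itv /=; case: ifP => _; rewrite ltry. Qed.

Lemma measurable_cube n : measurable (@cube n).
Proof.
have -> : @cube n = \bigcap_(i in [set: 'I_n])
    ((fun x : 'rV[R]_n => x ord0 i) @^-1` J).
  by apply/seteqP; split=> x /= H i => [_|]; exact: (H i).
apply: fin_bigcap_measurable => // i _.
by rewrite -[X in measurable X]setTI; apply: measurable_coor.
Qed.

Lemma cube_cons n t (y : 'rV[R]_n) : cube (cons_rV (t, y)) <-> J t /\ cube y.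
Proof.
split=> [H|[Jt Hy] i].
  split; first by have := H ord0; rewrite cons_rV0.
  by move=> i; have := H (lift ord0 i); rewrite cons_rVS.
have [j ->|->] := unliftP ord0 i; last by rewrite cons_rV0.
by rewrite cons_rVS; exact: Hy.
Qed.

Lemma measurable_cons_rVl n t : measurable_fun setT (fun y : 'rV[R]_n => cons_rV (t, y)).
Proof.
by apply: (measurableT_comp (@measurable_cons_rV R n)); exact: measurable_fun_pair.
Qed.

Lemma measurable_cons_rVr n (y : 'rV[R]_n) : measurable_fun setT (fun t => cons_rV (t, y)).
Proof.
by apply: (measurableT_comp (@measurable_cons_rV R n)); exact: measurable_fun_pair.
Qed.

Section tonelli.
Variables (n : nat) (f : 'rV[R]_n.+1 -> \bar R).
Hypotheses (mf : measurable_fun setT f) (f0 : forall x, (0 <= f x)%E).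

Let integral_lebesgue_rVS : (\int[lebesgue_rV n.+1]_x f x =
  \int[leb \x lebesgue_rV n]_z f (cons_rV z))%E.
Proof.
have mc : @measurable_fun _ _ (measurableTypeR R * 'rV[R]_n)%type 'rV[R]_n.+1
  setT (@cons_rV R n) := @measurable_cons_rV R n.
rewrite -[RHS](ge0_integral_pushforward mc (leb \x lebesgue_rV n)%E measurableT mf)//.
Qed.

Let mfcons : measurable_fun setT (f \o @cons_rV R n).
Proof. exact: measurableT_comp mf (@measurable_cons_rV R n). Qed.

(** Both orders of integration are needed: the first coordinate is outermost in inductions on the
    dimension, and innermost for one-dimensional calculus in that coordinate. *)
Lemma lebesgue_rV_tonelli1 : (\int[lebesgue_rV n.+1]_x f x =
  \int[leb]_t \int[lebesgue_rV n]_y f (cons_rV (t, y)))%E.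
Proof. by rewrite integral_lebesgue_rVS fubini_tonelli1. Qed.

Lemma lebesgue_rV_tonelli2 : (\int[lebesgue_rV n.+1]_x f x =
  \int[lebesgue_rV n]_y \int[leb]_t f (cons_rV (t, y)))%E.
Proof. by rewrite integral_lebesgue_rVS fubini_tonelli1// fubini_tonelli. Qed.

Lemma measurable_tonelli1 :
  measurable_fun setT (fun t => \int[lebesgue_rV n]_y f (cons_rV (t, y)))%E.
Proof.
exact: (@measurable_fun_fubini_tonelli_F _ _ _ _ _ (lebesgue_rV n) (f \o @cons_rV R n)
  mfcons (fun=> f0 _)).
Qed.

Lemma measurable_tonelli2 :
  measurable_fun setT (fun y => \int[leb]_t f (cons_rV (t, y)))%E.
Proof.
exact: (@measurable_fun_fubini_tonelli_G _ _ _ _ _ leb (f \o @cons_rV R n)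
  mfcons (fun=> f0 _)).
Qed.

End tonelli.

Section tonelli_cube.
Variables (n : nat) (f : 'rV[R]_n.+1 -> \bar R).
Hypotheses (mf : measurable_fun setT f) (f0 : forall x, (0 <= f x)%E).

Let fc := f \_ (@cube n.+1).

Let mfc : measurable_fun setT fc.
Proof.
have := (measurable_restrictT f (@measurable_cube n.+1)).1; apply; exact: measurable_funTS.
Qed.

Let fc0 x : (0 <= fc x)%E.
Proof. by rewrite /fc patchE; case: ifP. Qed.

Let fcE t y : fc (cons_rV (t, y)) =
  if t \in J then ((fun z => f (cons_rV (t, z))) \_ (@cube n)) y else 0%E.
Proof.
rewrite /fc !patchE; have [Jt|Jt] := boolP (t \in J); last first.
  by rewrite memNset// => /cube_cons[]; move: Jt; rewrite notin_setE.
rewrite (_ : (_ \in cube (n:=n.+1)) = (y \in @cube n))//.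
apply/idP/idP; rewrite !inE => H; first by case/cube_cons : H.
by apply/cube_cons; split => //; rewrite inE in Jt.
Qed.

Lemma cube_tonelli1 : (\int[lebesgue_rV n.+1]_(x in @cube n.+1) f x =
  \int[leb]_(t in J) \int[lebesgue_rV n]_(y in @cube n) f (cons_rV (t, y)))%E.
Proof.
rewrite integral_mkcond (@lebesgue_rV_tonelli1 n fc mfc fc0) [RHS]integral_mkcond.
apply: eq_integral => t _; under eq_integral => y _ do rewrite fcE.
rewrite patchE; case: ifP => _; last by rewrite integral0.
by rewrite [RHS]integral_mkcond.
Qed.

Lemma cube_tonelli2 : (\int[lebesgue_rV n.+1]_(x in @cube n.+1) f x =
  \int[lebesgue_rV n]_(y in @cube n) \int[leb]_(t in J) f (cons_rV (t, y)))%E.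
Proof.
rewrite integral_mkcond (@lebesgue_rV_tonelli2 n fc mfc fc0) [RHS]integral_mkcond.
apply: eq_integral => y _; rewrite patchE; case: ifP => cy.
  rewrite [RHS]integral_mkcond; apply: eq_integral => t _.
  by rewrite [LHS]fcE !patchE cy.
by apply: integral0_eq => t _; rewrite [LHS]fcE !patchE cy; case: ifP.
Qed.

End tonelli_cube.

Lemma cube_fin n : (lebesgue_rV n (@cube n) < +oo)%E.
Proof.
elim: n => [|n IHn].
  rewrite (@le_lt_trans _ _ (\d_(0 : 'rV[R]_0) setT))//.
    by apply: le_measure; rewrite ?inE//; exact: measurable_cube.
  by rewrite diracT ltry.
have := @cube_tonelli1 n (cst 1%E) (measurable_cst _) (fun=> lee01).
rewrite !integral_cst//; last exact: measurable_cube.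
rewrite mul1e => ->.
under eq_integral => t _.
  rewrite (_ : integral _ _ _ = lebesgue_rV n (@cube n)); first over.
  by rewrite -[RHS]mul1e -(integral_cst _ (@measurable_cube n)).
rewrite integral_cst//.
by rewrite lte_mul_pinfty// ?ge0_fin_numE//; exact: itv_fin.
Qed.

Lemma bounded_measurable_slicel n (f : 'rV[R]_n.+1 -> R) t : bounded_measurable f ->
  bounded_measurable (fun y : 'rV[R]_n => f (cons_rV (t, y))).
Proof.
move=> [mf [M Mf]]; split; last by exists M.
exact: (measurableT_comp mf (@measurable_cons_rVl n t)).
Qed.

Lemma bounded_measurable_slicer n (f : 'rV[R]_n.+1 -> R) (y : 'rV[R]_n) :
  bounded_measurable f -> bounded_measurable (fun t => f (cons_rV (t, y))).
Proof.
move=> [mf [M Mf]]; split; last by exists M.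
exact: (measurableT_comp mf (@measurable_cons_rVr n y)).
Qed.

Definition cube_integral n (f : 'rV[R]_n -> R) : R := \int[lebesgue_rV n]_(x in @cube n) f x.
Local Notation cubeI := cube_integral.

Definition itv_integral (f : R -> R) : R := \int[leb]_(t in J) f t.
Local Notation itvI := itv_integral.

Let cubeI_integrable n (f : 'rV[R]_n -> R) : bounded_measurable f ->
  (lebesgue_rV n).-integrable (@cube n) (EFin \o f).
Proof.
by move=> bf; apply: bounded_measurable_integrable => //; [exact: measurable_cube|exact: cube_fin].
Qed.

Let itvI_integrable (f : R -> R) : bounded_measurable f ->
  leb.-integrable J (EFin \o f).
Proof. by move=> bf; apply: bounded_measurable_integrable => //; exact: itv_fin. Qed.

Lemma cubeI_fin n (f : 'rV[R]_n -> R) : bounded_measurable f ->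
  (\int[lebesgue_rV n]_(x in @cube n) (f x)%:E = (cubeI f)%:E)%E.
Proof.
move=> bf; rewrite /cube_integral /Rintegral fineK//.
by apply: integrable_fin_num; [exact: measurable_cube|exact: cubeI_integrable].
Qed.

Lemma itvI_fin (f : R -> R) : bounded_measurable f ->
  (\int[leb]_(t in J) (f t)%:E = (itvI f)%:E)%E.
Proof.
move=> bf; rewrite /itv_integral /Rintegral fineK//.
by apply: integrable_fin_num => //; exact: itvI_integrable.
Qed.

Lemma cubeID n (f g : 'rV[R]_n -> R) : bounded_measurable f -> bounded_measurable g ->
  cubeI (fun x => f x + g x) = cubeI f + cubeI g.
Proof.
by move=> bf bg; apply: RintegralD; [exact: measurable_cube|exact: cubeI_integrable..].
Qed.

Lemma cubeIZ n a (f : 'rV[R]_n -> R) : bounded_measurable f ->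
  cubeI (fun x => a * f x) = a * cubeI f.
Proof.
by move=> bf; apply: RintegralZl; [exact: measurable_cube|exact: cubeI_integrable].
Qed.

Lemma cubeI_cst n a : cubeI (fun _ : 'rV[R]_n => a) = a * cubeI (fun _ : 'rV[R]_n => 1).
Proof.
rewrite -cubeIZ; last exact: bounded_measurable_cst.
by apply: eq_Rintegral => x _; rewrite mulr1.
Qed.

Lemma cubeI_ge0 n (f : 'rV[R]_n -> R) : (forall x, 0 <= f x) -> 0 <= cubeI f.
Proof. by move=> f0; apply: Rintegral_ge0. Qed.

Lemma cubeI_le n (f g : 'rV[R]_n -> R) : bounded_measurable f -> bounded_measurable g ->
  (forall x, cube x -> f x <= g x) -> cubeI f <= cubeI g.
Proof.
by move=> bf bg fg; apply: le_Rintegral => //; [exact: measurable_cube|exact: cubeI_integrable..].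
Qed.

Lemma itvID (f g : R -> R) : bounded_measurable f -> bounded_measurable g ->
  itvI (fun x => f x + g x) = itvI f + itvI g.
Proof. by move=> bf bg; apply: RintegralD => //; exact: itvI_integrable. Qed.

Lemma itvIZ a (f : R -> R) : bounded_measurable f ->
  itvI (fun x => a * f x) = a * itvI f.
Proof. by move=> bf; apply: RintegralZl => //; exact: itvI_integrable. Qed.

Lemma itvI_cst a : 0 <= B -> itvI (fun=> a) = a * (2 * B).
Proof.
move=> B0; rewrite /itv_integral Rintegral_cst//= lebesgue_measure_itv/= lte_fin.
case: ifPn => /= [|h]; first by move=> _; ring.
by rewrite (_ : B = 0) ?mulr0//; lra.
Qed.

Lemma itvI_ge0 (f : R -> R) : (forall x, 0 <= f x) -> 0 <= itvI f.
Proof. by move=> f0; apply: Rintegral_ge0. Qed.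

Lemma itvI_le (f g : R -> R) : bounded_measurable f -> bounded_measurable g ->
  (forall x, J x -> f x <= g x) -> itvI f <= itvI g.
Proof. by move=> bf bg fg; apply: le_Rintegral => //; exact: itvI_integrable. Qed.

Lemma cubeI_norm n (f : 'rV[R]_n -> R) M : bounded_measurable f -> (forall x, `|f x| <= M) ->
  `|cubeI f| <= M * cubeI (fun _ : 'rV[R]_n => 1).
Proof.
move=> bf Mf; rewrite -cubeI_cst ler_norml; apply/andP; split.
  rewrite lerNl -mulN1r -cubeIZ//; apply: cubeI_le.
  - exact: bounded_measurableZ.
  - exact: bounded_measurable_cst.
  - by move=> x _; rewrite mulN1r; have := Mf x; rewrite ler_norml => /andP[]; lra.
apply: cubeI_le => //; first exact: bounded_measurable_cst.
by move=> x _; apply: le_trans (Mf x); exact: ler_norm.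
Qed.

End cube_integral.

Definition behead_rV (R : realType) n (x : 'rV[R]_n.+1) : 'rV[R]_n :=
  \row_i x ord0 (lift ord0 i).

Lemma behead_cons_rV (R : realType) n t (y : 'rV[R]_n) : behead_rV (cons_rV (t, y)) = y.
Proof. by apply/rowP => i; rewrite mxE cons_rVS. Qed.

Lemma measurable_behead_rV (R : realType) n : measurable_fun setT (@behead_rV R n).
Proof.
apply: measurable_fun_rVP => i; under eq_fun do rewrite mxE.
exact: measurable_coor.
Qed.

Lemma addr_ge0_of_norm_le (R : realDomainType) (a M : R) : `|a| <= M -> 0 <= a + M.
Proof. by rewrite ler_norml -lerBlDr sub0r => /andP[]. Qed.

(** * Fubini's theorem on a cube *)

Section fubini.
Context {R : realType}.
Variable B : R.

Local Notation leb := (@lebesgue_measure R).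
Local Notation J := `[(- B)%R, B]%classic.
Local Notation cubeI := (cube_integral B).
Local Notation itvI := (itv_integral B).

Lemma bounded_measurable_indic d (T : measurableType d) (A : set T) : measurable A ->
  bounded_measurable (\1_A : T -> R).
Proof.
move=> mA; split; first exact: measurable_indic.
by exists 1 => x; rewrite indicE normr_nat lern1 leq_b1.
Qed.

Let cubeI_slice_ge0 n (f : 'rV[R]_n.+1 -> R) : bounded_measurable f -> (forall x, 0 <= f x) ->
  measurable_fun setT (fun t => cubeI (fun y => f (cons_rV (t, y)))).
Proof.
move=> bf f0.
(* Only the variables of the inner integral are cut off, so that measurability in t is obtained on
   the whole line and not just on the segment. *)
pose g x := f x * \1_(@cube R B n) (behead_rV x).
have mg : measurable_fun setT (fun x => (g x)%:E).
  apply/measurable_EFinP; apply: measurable_funM; first by case: bf.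
  apply: measurableT_comp (measurable_behead_rV (n:=n)).
  by apply: measurable_indic; exact: measurable_cube.
have g0 x : (0 <= (g x)%:E)%E by rewrite lee_fin mulr_ge0.
have mfine : measurable_fun setT (fine : \bar R -> R) by exact: fine_measurable.
have := measurableT_comp mfine (measurable_tonelli1 mg g0).
apply: eq_measurable_fun => t _ /=.
rewrite /cube_integral /Rintegral; congr fine; rewrite [RHS]integral_mkcond.
apply: eq_integral => y _; rewrite /g behead_cons_rV patchE indicE.
by case: ifP => _ /=; rewrite ?mulr1 ?mulr0.
Qed.

Let itvI_slice_ge0 n (f : 'rV[R]_n.+1 -> R) : bounded_measurable f -> (forall x, 0 <= f x) ->
  measurable_fun setT (fun y : 'rV[R]_n => itvI (fun t => f (cons_rV (t, y)))).
Proof.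
move=> bf f0.
pose g x := f x * \1_J (x ord0 ord0).
have mg : measurable_fun setT (fun x => (g x)%:E).
  apply/measurable_EFinP; apply: measurable_funM; first by case: bf.
  by apply: measurableT_comp (measurable_coor ord0); apply: measurable_indic.
have g0 x : (0 <= (g x)%:E)%E by rewrite lee_fin mulr_ge0.
have mfine : measurable_fun setT (fine : \bar R -> R) by exact: fine_measurable.
have := measurableT_comp mfine (measurable_tonelli2 mg g0).
apply: eq_measurable_fun => y _ /=.
rewrite /itv_integral /Rintegral; congr fine; rewrite [RHS]integral_mkcond.
apply: eq_integral => t _; rewrite /g cons_rV0 patchE indicE.
by case: ifP => _ /=; rewrite ?mulr1 ?mulr0.
Qed.

(** Tonelli covers nonnegative integrands only. With M a bound of |f|, it is applied to f + M, and
    the integral of the constant is subtracted; the other signed statements of this section use the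
    same shift. *)
Lemma bounded_measurable_cubeI n (f : 'rV[R]_n.+1 -> R) : bounded_measurable f ->
  bounded_measurable (fun t => cubeI (fun y => f (cons_rV (t, y)))).
Proof.
move=> bf; have [mf [M Mf]] := bf.
have bM d' (T' : measurableType d') := @bounded_measurable_cst d' T' R M.
have bs t := bounded_measurable_slicel t bf.
split; last first.
  exists (M * cubeI (fun _ : 'rV[R]_n => 1)) => t; apply: cubeI_norm => //.
have : measurable_fun setT (fun t => cubeI (fun y => f (cons_rV (t, y)) + M)).
  apply: (cubeI_slice_ge0 (f := fun x => f x + M)).
    exact: bounded_measurableD.
  by move=> x; exact: addr_ge0_of_norm_le (Mf x).
move=> /measurable_funB /(_ (@measurable_cst _ _ _ _ setT (cubeI (fun _ : 'rV[R]_n => M)))).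
by apply: eq_measurable_fun => t _ /=; rewrite cubeID//; ring.
Qed.

Lemma bounded_measurable_itvI n (f : 'rV[R]_n.+1 -> R) : bounded_measurable f ->
  bounded_measurable (fun y : 'rV[R]_n => itvI (fun t => f (cons_rV (t, y)))).
Proof.
move=> bf; have [mf [M Mf]] := bf.
have bM d' (T' : measurableType d') := @bounded_measurable_cst d' T' R M.
have bs y := bounded_measurable_slicer y bf.
split; last first.
  exists (itvI (fun=> M)) => y; rewrite ler_norml; apply/andP; split.
    rewrite -mulN1r -itvIZ//; apply: itvI_le => //; first exact: bounded_measurableZ.
    by move=> t _; have := Mf (cons_rV (t, y)); rewrite ler_norml => /andP[]; lra.
  by apply: itvI_le => // t _; apply: le_trans (Mf (cons_rV (t, y))); exact: ler_norm.
have : measurable_fun setT (fun y : 'rV[R]_n => itvI (fun t => f (cons_rV (t, y)) + M)).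
  apply: (itvI_slice_ge0 (f := fun x => f x + M)).
    exact: bounded_measurableD.
  by move=> x; exact: addr_ge0_of_norm_le (Mf x).
move=> /measurable_funB /(_ (@measurable_cst _ _ _ _ setT (itvI (fun _ => M)))).
by apply: eq_measurable_fun => y _ /=; rewrite itvID//; ring.
Qed.

Let cubeI_fubini1_ge0 n (f : 'rV[R]_n.+1 -> R) : bounded_measurable f -> (forall x, 0 <= f x) ->
  cubeI f = itvI (fun t => cubeI (fun y => f (cons_rV (t, y)))).
Proof.
move=> bf f0; apply: EFin_inj; rewrite -cubeI_fin// cube_tonelli1//.
- rewrite -itvI_fin; last exact: bounded_measurable_cubeI.
  by apply: eq_integral => t _; rewrite cubeI_fin//; exact: bounded_measurable_slicel.
- by apply/measurable_EFinP; case: bf.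
Qed.

Let cubeI_fubini2_ge0 n (f : 'rV[R]_n.+1 -> R) : bounded_measurable f -> (forall x, 0 <= f x) ->
  cubeI f = cubeI (fun y : 'rV[R]_n => itvI (fun t => f (cons_rV (t, y)))).
Proof.
move=> bf f0; apply: EFin_inj; rewrite -cubeI_fin// cube_tonelli2//.
- rewrite -cubeI_fin; last exact: bounded_measurable_itvI.
  by apply: eq_integral => y _; rewrite itvI_fin//; exact: bounded_measurable_slicer.
- by apply/measurable_EFinP; case: bf.
Qed.

Lemma cubeI_fubini1 n (f : 'rV[R]_n.+1 -> R) : bounded_measurable f ->
  cubeI f = itvI (fun t => cubeI (fun y => f (cons_rV (t, y)))).
Proof.
move=> bf; have [mf [M Mf]] := bf.
have M0 : 0 <= M by apply: le_trans (Mf 0).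
have bM d' (T' : measurableType d') := @bounded_measurable_cst d' T' R M.
have := @cubeI_fubini1_ge0 n (fun x => f x + M) (bounded_measurableD bf (bM _ _)).
rewrite cubeID// (cubeI_fubini1_ge0 (bM _ _) (fun=> M0)) => H.
apply: (addIr (itvI (fun=> cubeI (fun _ : 'rV[R]_n => M)))); rewrite H; last first.
  by move=> x; exact: addr_ge0_of_norm_le (Mf x).
rewrite -itvID; last 2 first.
- exact: bounded_measurable_cubeI.
- exact: bounded_measurable_cst.
by congr itvI; apply/funext => t; rewrite cubeID//; exact: bounded_measurable_slicel.
Qed.

Lemma cubeI_fubini2 n (f : 'rV[R]_n.+1 -> R) : bounded_measurable f ->
  cubeI f = cubeI (fun y : 'rV[R]_n => itvI (fun t => f (cons_rV (t, y)))).
Proof.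
move=> bf; have [mf [M Mf]] := bf.
have M0 : 0 <= M by apply: le_trans (Mf 0).
have bM d' (T' : measurableType d') := @bounded_measurable_cst d' T' R M.
have := @cubeI_fubini2_ge0 n (fun x => f x + M) (bounded_measurableD bf (bM _ _)).
rewrite cubeID// (cubeI_fubini2_ge0 (bM _ _) (fun=> M0)) => H.
apply: (addIr (cubeI (fun _ : 'rV[R]_n => itvI (fun=> M)))); rewrite H; last first.
  by move=> x; exact: addr_ge0_of_norm_le (Mf x).
rewrite -cubeID; last 2 first.
- exact: bounded_measurable_itvI.
- exact: bounded_measurable_cst.
by congr cubeI; apply/funext => y; rewrite itvID//; exact: bounded_measurable_slicer.
Qed.

End fubini.

(** * Partial derivatives of slices *)

Section derivatives.
Context {R : realType}.

Lemma continuous_bounded_measurable n (f : 'rV[R]_n -> R) : continuous f ->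
  measurable_fun setT f.
Proof.
move=> cf; apply: (measurability _ (measurable_realfun.RGenOpens.measurableE R)).
move=> _ [_ [a [b ->] <-]]; rewrite setTI; apply: open_measurable_rV.
by apply: open_comp => [x _|]; [exact: cf|exact: interval_open].
Qed.

Let ball_cons_rV n (t t' e : R) (y y' : 'rV[R]_n) : 0 < e -> ball t e t' -> ball y e y' ->
  ball (cons_rV (t, y)) e (cons_rV (t', y')).
Proof.
move=> e0 tt' yy'; split => // i j; rewrite ord1.
have [k ->|->] := unliftP ord0 j; last by rewrite !cons_rV0.
by rewrite !cons_rVS; exact: (yy'.2 ord0 k).
Qed.

Lemma continuous_cons_rVl n t : continuous (fun y : 'rV[R]_n => cons_rV (t, y)).
Proof.
move=> y A /nbhs_ballP[e /= e0 eA]; apply/nbhs_ballP; exists e => //= y' yy'.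
by apply: eA; apply: ball_cons_rV => //; exact: ballxx.
Qed.

Lemma continuous_cons_rVr n (y : 'rV[R]_n) : continuous (fun t => cons_rV (t, y)).
Proof.
move=> t A /nbhs_ballP[e /= e0 eA]; apply/nbhs_ballP; exists e => //= t' tt'.
by apply: eA; apply: ball_cons_rV => //; exact: ballxx.
Qed.

(** Shifts along an axis commute with [cons_rV], so the difference quotients of a slice are those of
    f. Derivatives of slices are then obtained by rewriting, without a chain rule. *)
Let cons_shift_lift n (h t : R) (y : 'rV[R]_n) i :
  h *: delta_mx ord0 (lift ord0 i) + cons_rV (t, y) = cons_rV (t, h *: delta_mx ord0 i + y).
Proof.
apply/rowP => j; rewrite mxE.
have [k ->|->] := unliftP ord0 j.
  by rewrite !cons_rVS !mxE/= (inj_eq lift_inj).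
by rewrite !cons_rV0 !mxE eq_liftF/= mulr0 add0r.
Qed.

Let cons_shift0 n (h t : R) (y : 'rV[R]_n) :
  h *: delta_mx ord0 ord0 + cons_rV (t, y) = cons_rV (h *: 1 + t, y).
Proof.
apply/rowP => j; rewrite mxE.
have [k ->|->] := unliftP ord0 j.
  by rewrite !cons_rVS !mxE lift_eqF/= mulr0 add0r.
by rewrite !cons_rV0 !mxE eqxx.
Qed.

Lemma derivable_slicel n (f : 'rV[R]_n.+1 -> R) i t (y : 'rV[R]_n) :
  derivable f (cons_rV (t, y)) (delta_mx ord0 (lift ord0 i)) ->
  derivable (fun y => f (cons_rV (t, y))) y (delta_mx ord0 i).
Proof.
move=> df; rewrite /derivable (_ : (fun h => _) = (fun h => h^-1 *: ((f \o shift (cons_rV (t, y)))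
  (h *: delta_mx ord0 (lift ord0 i)) - f (cons_rV (t, y)))))//.
by apply/funext => h /=; rewrite cons_shift_lift.
Qed.

Lemma partial_slicel n (f : 'rV[R]_n.+1 -> R) i t (y : 'rV[R]_n) :
  partial i (fun y => f (cons_rV (t, y))) y = partial (lift ord0 i) f (cons_rV (t, y)).
Proof.
rewrite /partial /derive
  [X in lim (X @ _) = _](_ : _ = (fun h => h^-1 *: ((f \o shift (cons_rV (t, y)))
  (h *: delta_mx ord0 (lift ord0 i)) - f (cons_rV (t, y)))))//.
by apply/funext => h /=; rewrite cons_shift_lift.
Qed.

Lemma derivable_slicer n (f : 'rV[R]_n.+1 -> R) t (y : 'rV[R]_n) :
  derivable f (cons_rV (t, y)) (delta_mx ord0 ord0) ->
  derivable (fun t => f (cons_rV (t, y))) t 1.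
Proof.
move=> df; rewrite /derivable (_ : (fun h => _) = (fun h => h^-1 *: ((f \o shift (cons_rV (t, y)))
  (h *: delta_mx ord0 ord0) - f (cons_rV (t, y)))))//.
by apply/funext => h /=; rewrite cons_shift0.
Qed.

Lemma partial_slicer n (f : 'rV[R]_n.+1 -> R) t (y : 'rV[R]_n) :
  derive1 (fun t => f (cons_rV (t, y))) t = partial ord0 f (cons_rV (t, y)).
Proof.
rewrite derive1E /partial /derive
  [X in lim (X @ _) = _](_ : _ = (fun h => h^-1 *: ((f \o shift (cons_rV (t, y)))
  (h *: delta_mx ord0 ord0) - f (cons_rV (t, y)))))//.
by apply/funext => h /=; rewrite cons_shift0.
Qed.

End derivatives.

(** * Calculus on a segment *)

Lemma inner_cauchy_schwarz {d} {T : measurableType d} {R : realType}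
    (mu : {measure set T -> \bar R}) (D : set T) f g : measurable D ->
  sqint mu D f -> sqint mu D g ->
  inner mu D f g ^+ 2 <= inner mu D f f * inner mu D g g.
Proof.
move=> mD; apply: (@cauchy_schwarz _ _ (sqint mu D)).
- by move=> *; exact: sqintP.
- exact: innerC.
- by move=> *; exact: innerP.
- exact: inner_ge0.
Qed.

Section itv.
Context {R : realType}.
Variable B : R.
Local Notation leb := (@lebesgue_measure R).
Local Notation J := `[(- B)%R, B]%classic.
Local Notation itvI := (itv_integral B).
Local Notation cubeI := (cube_integral B).

Lemma itvI_cauchy_schwarz (f g : R -> R) : bounded_measurable f -> bounded_measurable g ->
  itvI (fun t => f t * g t) ^+ 2 <= itvI (fun t => f t ^+ 2) * itvI (fun t => g t ^+ 2).
Proof.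
move=> bf bg; apply: (@inner_cauchy_schwarz _ _ _ leb) => //.
- by apply: bounded_measurable_sqint => //; exact: itv_fin.
- by apply: bounded_measurable_sqint => //; exact: itv_fin.
Qed.

Lemma cubeI_cauchy_schwarz n (f g : 'rV[R]_n -> R) :
  bounded_measurable f -> bounded_measurable g ->
  cubeI (fun t => f t * g t) ^+ 2 <= cubeI (fun t => f t ^+ 2) * cubeI (fun t => g t ^+ 2).
Proof.
move=> bf bg; apply: (@inner_cauchy_schwarz _ _ _ (lebesgue_rV n)).
- exact: measurable_cube.
- by apply: bounded_measurable_sqint => //; [exact: measurable_cube|exact: cube_fin].
- by apply: bounded_measurable_sqint => //; [exact: measurable_cube|exact: cube_fin].
Qed.

Lemma bounded_measurable_sum d (T : measurableType d) (I : finType) (f : I -> T -> R) :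
  (forall i, bounded_measurable (f i)) -> bounded_measurable (fun x => \sum_i f i x).
Proof.
move=> bf; have H (s : seq I) : bounded_measurable (fun x => \sum_(i <- s) f i x).
  elim: s => [|i s IH].
    by under eq_fun do rewrite big_nil; exact: bounded_measurable_cst.
  by under eq_fun do rewrite big_cons; exact: bounded_measurableD.
exact: H.
Qed.

Lemma itvI_sum (I : finType) (f : I -> R -> R) : (forall i, bounded_measurable (f i)) ->
  itvI (fun x => \sum_i f i x) = \sum_i itvI (f i).
Proof.
move=> bf; have H (s : seq I) : bounded_measurable (fun x => \sum_(i <- s) f i x) /\
    itvI (fun x => \sum_(i <- s) f i x) = \sum_(i <- s) itvI (f i).
  elim: s => [|i s [bs IH]].
    rewrite big_nil; under eq_fun do rewrite big_nil.
    split; first exact: bounded_measurable_cst.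
    have := @itvIZ R B 0 (fun=> 0) (bounded_measurable_cst _); by rewrite !mul0r.
  rewrite big_cons; under eq_fun do rewrite big_cons.
  by split; [exact: bounded_measurableD|rewrite itvID// IH].
by have [_ ] := H (index_enum I).
Qed.

(** Integrals over subintervals are written against indicators over the whole segment, the form in
    which they become weights in [ehrling]. *)
Lemma itvI_restrict (f : R -> R) a b : - B <= a -> b <= B ->
  itvI (fun t => \1_(`[a, b]%classic) t * f t) = \int[leb]_(t in `[a, b]) f t.
Proof.
move=> Ba bB; rewrite /itv_integral Rintegral_mkcond [RHS]Rintegral_mkcond.
apply: eq_Rintegral => t _; rewrite !patchE indicE.
have [tab|tab] := boolP (t \in `[a, b]%classic); last by rewrite mul0r; case: ifP.
rewrite mul1r mem_set//; move: tab; rewrite inE /= !in_itv/= => /andP[at_ tb].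
by rewrite (le_trans Ba)// (le_trans tb).
Qed.

Lemma itvI_indic a b : - B <= a -> a <= b -> b <= B -> itvI (\1_(`[a, b]%classic)) = b - a.
Proof.
move=> Ba ab bB; rewrite (_ : \1_(`[a, b]%classic) =
    (fun t => \1_(`[a, b]%classic) t * 1)); last first.
  by apply/funext => t; rewrite mulr1.
rewrite itvI_restrict// Rintegral_cst//= lebesgue_measure_itv/= lte_fin mul1r.
by move: ab; rewrite le_eqVlt => /predU1P[->|->//]; rewrite ltxx subrr.
Qed.

Section ftc.
Variable F : R -> R.
Hypotheses (dF : forall x, derivable F x 1) (cF' : continuous (derive1 F)).

Let cF : continuous F.
Proof. by move=> x; apply: differentiable_continuous; exact/derivable1_diffP. Qed.

Lemma Rintegral_derive1 a b : a <= b ->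
  \int[leb]_(t in `[a, b]) derive1 F t = F b - F a.
Proof.
rewrite le_eqVlt => /predU1P[->|ab].
  by rewrite set_itv1 Rintegral_set1 subrr.
suff H : (\int[leb]_(t in `[a, b]) (derive1 F t)%:E = (F b)%:E - (F a)%:E)%E.
  by rewrite /Rintegral H.
apply: (continuous_FTC2 ab); last by [].
- exact: continuous_subspaceT.
- split; first by move=> x _; exact: dF.
  + by apply: cvg_at_right_filter; exact: cF.
  + by apply: cvg_at_left_filter; exact: cF.
Qed.

Hypothesis bF' : bounded_measurable (derive1 F).

Lemma itvI_derive1 : 0 <= B -> itvI (derive1 F) = F B - F (- B).
Proof. by move=> B0; rewrite /itv_integral Rintegral_derive1//; lra. Qed.

(** Cauchy-Schwarz for F' against the indicator of [s, t]: Hoelder continuity of exponent 1/2, with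
    a constant that does not depend on s and t. *)
Lemma sqr_increment_le s t h : J s -> J t -> `|t - s| <= h ->
  (F t - F s) ^+ 2 <= h * itvI (fun t => derive1 F t ^+ 2).
Proof.
wlog st : s t / s <= t.
  move=> H Js Jt sth; have [st|/ltW ts] := leP s t; first exact: H.
  by rewrite -sqrrN opprB; apply: H => //; rewrite distrC.
rewrite /= !in_itv/= => /andP[Bs sB] /andP[Bt tB].
rewrite ger0_norm ?subr_ge0// => sth.
rewrite -Rintegral_derive1// -itvI_restrict//.
have b1 : bounded_measurable (\1_(`[s, t]%classic) : R -> R).
  by apply: bounded_measurable_indic; exact: measurable_itv.
apply: le_trans (itvI_cauchy_schwarz b1 bF') _.
rewrite (_ : (fun t0 => _ ^+ 2) = \1_(`[s, t]%classic)); last first.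
  by apply/funext => x; rewrite indicE expr2 -natrM mulnb andbb.
rewrite itvI_indic//; apply: ler_wpM2r => //.
by apply: itvI_ge0 => x; exact: sqr_ge0.
Qed.

End ftc.

(** If m is the mean of g over the piece, then |g - m| <= K there and g^2 <= 2 m^2 + 2 K^2;
    integration over the length h gives the two terms. *)
Lemma itvI_sqr_piece (g : R -> R) a h K : bounded_measurable g -> 0 < h ->
  - B <= a -> a + h <= B ->
  (forall s t, a <= s <= a + h -> a <= t <= a + h -> `|g t - g s| <= K) ->
  itvI (fun t => \1_(`[a, a + h]%classic) t * g t ^+ 2) <=
  2 / h * itvI (fun t => \1_(`[a, a + h]%classic) t * g t) ^+ 2 + 2 * h * K ^+ 2.
Proof.
move=> bg h0 Ba ahB gK; pose A := `[a, a + h]%classic.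
have b1 : bounded_measurable (\1_A : R -> R).
  by apply: bounded_measurable_indic; exact: measurable_itv.
have ah : a <= a + h by lra.
have I1 : itvI \1_A = h by rewrite itvI_indic//; ring.
set I := (X in 2 / h * X ^+ 2).
pose m := I / h.
have Ih : I = m * h by rewrite /m divfK// gt_eqF.
have bAg : bounded_measurable (fun t => \1_A t * g t) by exact: bounded_measurableM.
have dev t : a <= t <= a + h -> `|g t - m| <= K.
  move=> tA; rewrite -(ler_pM2r h0) -[X in _ * X <= _]gtr0_norm// -normrM mulrBl -Ih.
  have -> : g t * h - I = itvI (fun s => g t * \1_A s + (-1) * (\1_A s * g s)).
    rewrite itvID; [|exact: bounded_measurableZ..].
    by rewrite !itvIZ// I1 mulN1r.
  have bd : bounded_measurable (fun s => g t * \1_A s + (-1) * (\1_A s * g s)).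
    by apply: bounded_measurableD; exact: bounded_measurableZ.
  have Kg s : `|g t * \1_A s + (-1) * (\1_A s * g s)| <= K * \1_A s.
    rewrite indicE; have [sA|_] := boolP (s \in A); last by rewrite /= !(mulr0, mul0r) addr0 normr0.
    rewrite /= !mulr1 mul1r mulN1r; apply: gK => //.
    by move: sA; rewrite inE /A /= in_itv.
  have bK : bounded_measurable (fun s => K * \1_A s) by exact: bounded_measurableZ.
  rewrite -I1 -itvIZ// ler_norml; apply/andP; split.
    rewrite -[X in X <= _]mulN1r -itvIZ//; apply: itvI_le => //; first exact: bounded_measurableZ.
    by move=> s _; rewrite [X in X <= _]mulN1r; have := Kg s; rewrite ler_norml => /andP[].
  by apply: itvI_le => // s _; apply: le_trans (Kg s); exact: ler_norm.
have -> : 2 / h * I ^+ 2 + 2 * h * K ^+ 2 = (2 * m ^+ 2 + 2 * K ^+ 2) * itvI \1_A.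
  by rewrite I1 Ih; field; rewrite gt_eqF.
rewrite -itvIZ//; apply: itvI_le.
- by apply: bounded_measurableM => //; exact: bounded_measurableX.
- exact: bounded_measurableZ.
move=> t _; rewrite mulrC; have [tA|tA] := boolP (t \in A); last first.
  by rewrite indicE (negbTE tA) !mulr0.
rewrite ler_wpM2r//.
have /dev : a <= t <= a + h by move: tA; rewrite inE /A /= in_itv.
rewrite -[_ <= K]ler_sqr ?nnegrE//; last first.
  by apply: le_trans (gK a a _ _) => //; rewrite lexx.
rewrite real_normK ?num_real// => H.
(* This is g^2 <= 2 m^2 + 2 (g - m)^2, whose two sides differ by (g - 2 m)^2. *)
by have := sqr_ge0 (g t - 2 * m); move: (g t) H => x H; nra.
Qed.

(** For j <= P these closed pieces of equal length cover [-B, B]. They share endpoints, which is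
    harmless: the cover only yields upper bounds for integrals of nonnegative functions. *)
Definition itv_piece (P : nat) (j : nat) : set R :=
  `[- B + j%:R * (2 * B / P.+1%:R), - B + j%:R * (2 * B / P.+1%:R) + 2 * B / P.+1%:R]%classic.

Lemma itvI_sqr_le (g : R -> R) P K : bounded_measurable g -> 0 < B ->
  (forall s t, J s -> J t -> `|t - s| <= 2 * B / P.+1%:R -> `|g t - g s| <= K) ->
  itvI (fun t => g t ^+ 2) <=
  2 / (2 * B / P.+1%:R) * \sum_(j < P.+1) itvI (fun t => \1_(itv_piece P j) t * g t) ^+ 2
    + 4 * B * K ^+ 2.
Proof.
move=> bg B0 gK; set h := 2 * B / P.+1%:R.
have P0 : (0 < P.+1%:R :> R) by rewrite ltr0n.
have h0 : 0 < h by rewrite divr_gt0// mulr_gt0.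
have hP : P.+1%:R * h = 2 * B by rewrite /h mulrC divfK// gt_eqF.
have bp j : bounded_measurable (\1_(itv_piece P j) : R -> R).
  by apply: bounded_measurable_indic; exact: measurable_itv.
have bpg (j : 'I_P.+1) : bounded_measurable (fun t => \1_(itv_piece P j) t * g t ^+ 2).
  by apply: bounded_measurableM => //; exact: bounded_measurableX.
apply: (@le_trans _ _ (\sum_(j < P.+1) itvI (fun t => \1_(itv_piece P j) t * g t ^+ 2))).
  rewrite -itvI_sum//; apply: itvI_le.
  - exact: bounded_measurableX.
  - exact: bounded_measurable_sum.
  move=> t /=; rewrite in_itv/= => /andP[Bt tB].
  suff [j jt] : exists j : 'I_P.+1, itv_piece P j t.
    rewrite (bigD1 j)//= indicE mem_set// mul1r lerDl.
    by apply: sumr_ge0 => i _; rewrite mulr_ge0// sqr_ge0.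
  (* Truncation would give the right endpoint the index P + 1, so it is put in the last piece. *)
  have [tB'|tB'] := eqVneq t B.
    exists ord_max; rewrite /itv_piece /= in_itv/= -/h tB'.
    move: hP; rewrite -natr1 mulrDl mul1r => hP.
    by apply/andP; split; lra.
  have q0 : 0 <= (t + B) / h by rewrite divr_ge0//; lra.
  have /andP[k1 k2] := truncn_itv q0; set k := Num.truncn _ in k1 k2.
  have kP : (k < P.+1)%N.
    rewrite -(ltr_nat R); apply: le_lt_trans k1 _.
    have : t < B by rewrite lt_neqAle tB'.
    by rewrite ltr_pdivrMr// hP; lra.
  move: k1 k2; rewrite ler_pdivlMr// ltr_pdivrMr// -natr1 mulrDl mul1r => k1 k2.
  by exists (Ordinal kP); rewrite /itv_piece /= in_itv/= -/h; apply/andP; split; lra.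
rewrite mulr_sumr.
have -> : 4 * B * K ^+ 2 = \sum_(j < P.+1) 2 * h * K ^+ 2.
  rewrite sumr_const card_ord -mulr_natl; transitivity (2 * (P.+1%:R * h) * K ^+ 2); last by ring.
  by rewrite hP; ring.
rewrite -big_split/=; apply: ler_sum => j _.
have j0 : 0 <= j%:R * h by rewrite mulr_ge0// ltW.
have jP : j%:R * h + h <= 2 * B.
  by rewrite -hP -{2}[h]mul1r -mulrDl ler_pM2r// natr1 ler_nat.
apply: itvI_sqr_piece => //; rewrite -/h; [lra|lra|].
move=> s t /andP[s1 s2] /andP[t1 t2]; apply: gK => //=; rewrite ?in_itv/=.
- by apply/andP; split; lra.
- by apply/andP; split; lra.
- by rewrite -/h ler_norml; apply/andP; split; lra.
Qed.

End itv.

(** * Calculus on a cube *)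

(** What the fundamental theorem of calculus asks on lines parallel to axis i, together with what
    Fubini asks of the derivative; the direction is a parameter because most arguments use only
    one. *)
Definition C1_bounded (R : realType) n (i : 'I_n) (f : 'rV[R]_n -> R) :=
  [/\ forall x, derivable f x (delta_mx ord0 i), continuous (partial i f) &
      bounded_measurable (partial i f)].

Section cube_calculus.
Context {R : realType}.
Variable B : R.
Hypothesis B0 : 0 < B.
Local Notation leb := (@lebesgue_measure R).
Local Notation J := `[(- B)%R, B]%classic.
Local Notation itvI := (itv_integral B).
Local Notation cubeI := (cube_integral B).

Lemma C1_bounded_slicel n (i : 'I_n) (f : 'rV[R]_n.+1 -> R) t :
  C1_bounded (lift ord0 i) f -> C1_bounded i (fun y => f (cons_rV (t, y))).
Proof.
move=> [df cf bf]; have pE : partial i (fun y => f (cons_rV (t, y))) =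
    fun y => partial (lift ord0 i) f (cons_rV (t, y)).
  by apply/funext => y; exact: partial_slicel.
split; first by move=> y; exact: derivable_slicel.
- rewrite pE => y; apply: (@continuous_comp _ _ _
    (fun y => cons_rV (t, y)) (partial (lift ord0 i) f)).
    exact: continuous_cons_rVl.
  exact: cf.
- by rewrite pE; exact: bounded_measurable_slicel.
Qed.

Lemma C1_bounded_slicer n (f : 'rV[R]_n.+1 -> R) (y : 'rV[R]_n) :
  C1_bounded ord0 f -> let g t := f (cons_rV (t, y)) in
  [/\ forall t, derivable g t 1, derive1 g = (fun t => partial ord0 f (cons_rV (t, y))),
     continuous (derive1 g) & bounded_measurable (derive1 g)].
Proof.
move=> [df cf bf] g.
have pE : derive1 g = fun t => partial ord0 f (cons_rV (t, y)).
  by apply/funext => t; exact: partial_slicer.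
split; [by move=> t; exact: derivable_slicer|exact: pE| |].
- rewrite pE => t; apply: (@continuous_comp _ _ _ (fun t => cons_rV (t, y)) (partial ord0 f)).
    exact: continuous_cons_rVr.
  exact: cf.
- by rewrite pE; exact: bounded_measurable_slicer.
Qed.

(** The divergence theorem for a field along axis i, without boundary terms. Fixing the first
    coordinate lowers the dimension until i is the first one, where the fundamental theorem of
    calculus applies on each line. *)
Lemma cubeI_partial n (i : 'I_n) (f : 'rV[R]_n -> R) : C1_bounded i f ->
  (forall x : 'rV[R]_n, `|x ord0 i| = B -> f x = 0) -> cubeI (partial i f) = 0.
Proof.
have c0 m : cubeI (fun _ : 'rV[R]_m => 0) = 0.
  by rewrite cubeI_cst mul0r.
have i0 : itvI (fun=> 0) = 0 by rewrite itvI_cst ?mul0r// ltW.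
elim: n i f => [[]//|n IH] i f Cf f0; have [_ _ bf] := Cf.
have [j ij|i_ord0] := unliftP ord0 i.
  rewrite cubeI_fubini1// -[RHS]i0; congr itvI; apply/funext => t.
  under eq_fun do rewrite ij -partial_slicel.
  apply: IH; first by apply: C1_bounded_slicel; rewrite -ij.
  by move=> y yB; apply: f0; rewrite ij cons_rVS.
rewrite i_ord0 in Cf f0 bf *.
rewrite cubeI_fubini2// -[RHS](c0 n); congr cubeI; apply/funext => y.
have [dg <- cg bg] := C1_bounded_slicer y Cf.
rewrite itvI_derive1//; last exact: ltW.
by rewrite !f0 ?subrr// cons_rV0 ?normrN gtr0_norm.
Qed.

(* In dimension n + 1, the estimate in dimension n is applied to the slices
   f (t, .); its functionals g t = \int f (t, .) w are Hoelder continuous in t,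
   hence well approximated by their means over short intervals. *)
Lemma ehrling n e : 0 < e -> exists (I : finType) (w : I -> 'rV[R]_n -> R) (C : R),
  [/\ 0 <= C, forall i, bounded_measurable (w i) & forall f,
   bounded_measurable f -> (forall j, C1_bounded j f) ->
   cubeI (fun x => f x ^+ 2) <= C * \sum_i cubeI (fun x => f x * w i x) ^+ 2 +
     e * \sum_j cubeI (fun x => partial j f x ^+ 2)].
Proof.
move=> e0; elim: n => [|n [I [w [C [C0 bw H]]]]].
  pose c := cubeI (fun _ : 'rV[R]_0 => 1).
  have c0 : 0 <= c by exact: cubeI_ge0.
  (* The space is a single point of mass c, and the integral is the only functional needed; c^-1
     also fits c = 0, where both sides vanish. *)
  exists unit, (fun _ _ => 1), c^-1; split; first by rewrite invr_ge0.
    by move=> _; exact: bounded_measurable_cst.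
  move=> f _ _; rewrite big_ord0 mulr0 addr0.
  rewrite (bigD1 tt)//= big1 ?addr0; last by case.
  have -> : (fun x => f x ^+ 2) = (fun=> f 0 ^+ 2).
    by apply/funext => x; rewrite (thinmx0 x).
  have -> : (fun x => f x * 1) = (fun=> f 0).
    by apply/funext => x; rewrite mulr1 (thinmx0 x).
  rewrite (cubeI_cst B 0 (f 0 ^+ 2)) (cubeI_cst B 0 (f 0)) -/c exprMn mulrCA.
  apply: ler_wpM2l; first exact: sqr_ge0.
  have [->|cn0] := eqVneq c 0; first by rewrite expr0n mulr0.
  by rewrite expr2 mulrA mulVf// mul1r.
pose W i := cubeI (fun x => w i x ^+ 2).
have W0 i : 0 <= W i by apply: cubeI_ge0 => x; exact: sqr_ge0.
pose S := \sum_i W i; have S0 : 0 <= S by exact: sumr_ge0.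
(* So many pieces that the total error of replacing the functionals by their means, C (4 B h S)
   times the integral of the squared first derivative, is absorbed by e. *)
pose P := Num.truncn (8 * B ^+ 2 * C * S / e).
pose h := 2 * B / P.+1%:R.
have P0 : (0 < P.+1%:R :> R) by rewrite ltr0n.
have h0 : 0 < h by rewrite divr_gt0// mulr_gt0.
have hC : C * (4 * B * h * S) <= e.
  have -> : C * (4 * B * h * S) = 8 * B ^+ 2 * C * S / P.+1%:R by rewrite /h; field; rewrite gt_eqF.
  rewrite ler_pdivrMr// [e * _]mulrC -ler_pdivrMr//.
  by apply: ltW; apply: truncnS_gt.
(* A new functional is an old one in the last n coordinates, integrated over one short interval of
   the first coordinate. *)
pose w' (ij : I * 'I_P.+1) (x : 'rV[R]_n.+1) :=
  w ij.1 (behead_rV x) * \1_(itv_piece B P ij.2) (x ord0 ord0).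
have bw' ij : bounded_measurable (w' ij).
  apply: bounded_measurableM.
    have [mw [M Mw]] := bw ij.1; split; last by exists M.
    exact: (measurableT_comp mw (@measurable_behead_rV R n)).
  split; last by exists 1 => x; rewrite indicE normr_nat lern1 leq_b1.
  apply: (measurableT_comp _ (measurable_coor ord0)).
  by apply: measurable_indic; exact: measurable_itv.
exists (I * 'I_P.+1)%type, w', (C * (2 / h)); split => //.
  by rewrite mulr_ge0// divr_ge0// ltW.
move=> f bf Cf.
have bsl t := bounded_measurable_slicel t bf.
pose g i t := cubeI (fun y => f (cons_rV (t, y)) * w i y).
have bfw i : bounded_measurable (fun x => f x * w i (behead_rV x)).
  apply: bounded_measurableM => //.
  have [mw [M Mw]] := bw i; split; last by exists M.
  exact: (measurableT_comp mw (@measurable_behead_rV R n)).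
have bg i : bounded_measurable (g i).
  have := bounded_measurable_cubeI B (bfw i); congr bounded_measurable.
  by apply/funext => t; rewrite /g; congr cube_integral; apply/funext => y; rewrite behead_cons_rV.
pose D := cubeI (fun x => partial ord0 f x ^+ 2).
have D0 : 0 <= D by apply: cubeI_ge0 => x; exact: sqr_ge0.
have [_ _ bp0] := Cf ord0.
(* Cauchy-Schwarz in y bounds the increment of g i by those of f along the lines in the first
   direction, and [sqr_increment_le] controls these line by line. *)
have osc i s t : J s -> J t -> `|t - s| <= h -> `|g i t - g i s| <= Num.sqrt (W i * (h * D)).
  move=> Js Jt sth; rewrite -sqrtr_sqr ler_wsqrtr//.
  have -> : g i t - g i s = cubeI (fun y => w i y * (f (cons_rV (t, y)) - f (cons_rV (s, y)))).
    rewrite /g -mulN1r -cubeIZ -?cubeID; last first.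
    - exact: bounded_measurableM.
    - by apply: bounded_measurableZ; exact: bounded_measurableM.
    - exact: bounded_measurableM.
    by congr cube_integral; apply/funext => y; ring.
  apply: le_trans (cubeI_cauchy_schwarz B (bw i) _) _; first exact: bounded_measurableB.
  apply: ler_wpM2l; first exact: W0.
  rewrite /D cubeI_fubini2; last exact: bounded_measurableX.
  have bI := bounded_measurable_itvI B (bounded_measurableX bp0).
  rewrite -cubeIZ//; apply: cubeI_le.
  - by apply: bounded_measurableX; exact: bounded_measurableB.
  - exact: bounded_measurableZ.
  move=> y _; have [dg gE cg bg'] := C1_bounded_slicer y (Cf ord0).
  by have := sqr_increment_le dg cg bg' Js Jt sth; rewrite gE.
have bf2 := bounded_measurableX bf.
rewrite cubeI_fubini1//.
pose G t := C * \sum_i g i t ^+ 2 +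
  e * \sum_j cubeI (fun y => partial (lift ord0 j) f (cons_rV (t, y)) ^+ 2).
have bp j : bounded_measurable (fun x => partial (lift ord0 j) f x ^+ 2).
  by apply: bounded_measurableX; case: (Cf (lift ord0 j)).
have bpI j := bounded_measurable_cubeI B (bp j).
have bsg : bounded_measurable (fun t => \sum_i g i t ^+ 2).
  by apply: bounded_measurable_sum => i; exact: bounded_measurableX.
have bsp : bounded_measurable (fun t =>
    \sum_j cubeI (fun y => partial (lift ord0 j) f (cons_rV (t, y)) ^+ 2)).
  exact: bounded_measurable_sum.
apply: (@le_trans _ _ (itvI G)).
  apply: itvI_le; first exact: (bounded_measurable_cubeI B bf2).
    by apply: bounded_measurableD; exact: bounded_measurableZ.
  move=> t Jt; apply: le_trans (H _ (bsl t) _) _.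
    by move=> j; exact: C1_bounded_slicel.
  rewrite /G; apply: lerD; first exact: lexx.
  apply: ler_wpM2l; first exact: ltW.
  apply: ler_sum => j _.
  by under eq_fun do rewrite partial_slicel.
have -> : itvI G = C * \sum_i itvI (fun t => g i t ^+ 2) +
    e * \sum_j cubeI (fun x => partial (lift ord0 j) f x ^+ 2).
  rewrite /G itvID; [|exact: bounded_measurableZ..].
  rewrite !itvIZ// !itvI_sum//; last by move=> i; exact: bounded_measurableX.
  by congr (_ + _ * _); apply: eq_bigr => j _; rewrite [RHS]cubeI_fubini1.
(* The last n directions are accounted for by the induction hypothesis; the term e D of the first
   direction remains, to absorb the errors of the means. *)
rewrite big_ord_recl mulrDr addrA lerD2r -/D.
have pieceE i (j : 'I_P.+1) : itvI (fun t => \1_(itv_piece B P j) t * g i t) =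
    cubeI (fun x => f x * w' (i, j) x).
  rewrite cubeI_fubini1; last exact: bounded_measurableM.
  congr itv_integral; apply/funext => t; rewrite /g -cubeIZ; last exact: bounded_measurableM.
  congr cube_integral; apply/funext => y; rewrite /w'/= behead_cons_rV cons_rV0; ring.
have gle i : itvI (fun t => g i t ^+ 2) <=
    2 / h * \sum_(j < P.+1) cubeI (fun x => f x * w' (i, j) x) ^+ 2 + 4 * B * (W i * (h * D)).
  have K2 : Num.sqrt (W i * (h * D)) ^+ 2 = W i * (h * D).
    by rewrite sqr_sqrtr// mulr_ge0// mulr_ge0// ltW.
  apply: le_trans (itvI_sqr_le (bg i) B0 (osc i)) _; rewrite -/h K2 lerD2r.
  apply: ler_wpM2l; first by rewrite divr_ge0// ltW.
  by apply: ler_sum => j _; rewrite -pieceE.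
apply: (@le_trans _ _ (C * \sum_i (2 / h * \sum_(j < P.+1) cubeI (fun x => f x * w' (i, j) x) ^+ 2
    + 4 * B * (W i * (h * D))))).
  by apply: ler_wpM2l => //; apply: ler_sum => i _.
rewrite big_split/= mulrDr -mulr_sumr mulrA pair_bigA/=.
have -> : \sum_i 4 * B * (W i * (h * D)) = 4 * B * h * S * D.
  by rewrite /S -!mulr_sumr -mulr_suml; ring.
rewrite (eq_bigr (fun ij => cubeI (fun x => f x * w' ij x) ^+ 2)); last by case.
by rewrite lerD2l mulrA; exact: ler_wpM2r.
Qed.

End cube_calculus.

(** * Test functions *)

Section test_function_algebra.
Context {R : realType} {n : nat}.
Variable Omega : set 'rV[R]_n.
Implicit Types f g psi phi : 'rV[R]_n -> R.

Definition derivable_along (i : 'I_n) f := forall x, derivable f x (delta_mx ord0 i).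

Lemma partial_lincomb (i : 'I_n) a f g : derivable_along i f -> derivable_along i g ->
  partial i (a *: f + g) = a *: partial i f + partial i g.
Proof.
move=> df dg; apply/funext => x; rewrite /partial deriveD//; last exact: derivableZ.
by rewrite deriveZ.
Qed.

Lemma continuously_differentiable_lincomb k a f g :
  continuously_differentiable k f -> continuously_differentiable k g ->
  continuously_differentiable k (a *: f + g).
Proof.
have cL f' g' : continuous f' -> continuous g' -> continuous (a *: f' + g').
  by move=> cf cg x; exact: (cvgD (cvgM (cvg_cst a) (cf x)) (cg x)).
elim: k f g => [|k IH] f g /= [cf Df] [cg Dg]; split => //; try exact: cL.
move=> i; have [df Pf] := Df i; have [dg Pg] := Dg i; split.
  by move=> x; apply: derivableD => //; exact: derivableZ.
by rewrite (partial_lincomb a df dg); exact: IH.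
Qed.

Lemma test_function0 : test_function Omega 0.
Proof.
have s0 : support_of (0 : 'rV[R]_n -> R) = set0.
  rewrite /support_of (_ : [set x | _] = set0) ?closure0//.
  by apply/seteqP; split => x //=; rewrite eqxx.
split; rewrite ?s0//; last exact: compact0.
rewrite (_ : 0 = cst 0 :> ('rV[R]_n -> R))//.
have c0 : continuous (cst 0 : 'rV[R]_n -> R) by exact: cst_continuous.
elim=> [|k IH] /=; split => //.
move=> i; split; first by move=> x; apply: derivable_cst.
rewrite (_ : partial i (cst 0) = cst 0)//; apply/funext => x.
exact: derive_cst.
Qed.

Lemma test_function_lincomb a f g : test_function Omega f -> test_function Omega g ->
  test_function Omega (a *: f + g).
Proof.
move=> [sf cf fO] [sg cg gO].
have sub : support_of (a *: f + g) `<=` support_of f `|` support_of g.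
  rewrite /support_of -closureU; apply: closureS => x /= H.
  have [fx0|fx0] := eqVneq (f x) 0; last by left.
  right; apply: contra_neq H => gx0.
  by rewrite [LHS](_ : _ = a * f x + g x)// fx0 gx0 mulr0 addr0.
split.
- by move=> k; exact: continuously_differentiable_lincomb.
- apply: subclosed_compact sub; first exact: closed_closure.
  exact: compactU.
- by move=> x /sub [/fO|/gO].
Qed.

Lemma test_function_continuous psi : test_function Omega psi -> continuous psi.
Proof. by move=> [/(_ 0%N)[]]. Qed.

Lemma test_function_derivable psi i : test_function Omega psi -> derivable_along i psi.
Proof. by move=> [/(_ 1%N)[_ /(_ i)[]]]. Qed.

(** A point off the closed support has a neighbourhood where psi is 0, so the derivative vanishes
    there. *)
Lemma support_of_partial psi (i : 'I_n) : support_of (partial i psi) `<=` support_of psi.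
Proof.
have cs : closed (support_of psi) by exact: closed_closure.
rewrite [X in _ `<=` X]((closure_id _).1 cs).
apply: closureS => x /=; apply: contra_neqP => nsx.
rewrite /partial (@near_eq_derive _ _ _ psi (cst 0)) ?derive_cst//.
have : open (~` support_of psi) by apply: closed_openC; exact: closed_closure.
rewrite openE => /(_ x nsx); apply: filterS => y nsy /=.
by apply/eqP; apply: contrapT => /negP py; apply: nsy; exact: subset_closure.
Qed.

Lemma test_function_partial psi i : test_function Omega psi ->
  test_function Omega (partial i psi).
Proof.
move=> [sp cp pO]; split.
- by move=> k; have [_ /(_ i)[]] := sp k.+1.
- apply: subclosed_compact (@support_of_partial psi i) => //; exact: closed_closure.
- by move=> x /support_of_partial/pO.
Qed.

Lemma test_function_out psi x : test_function Omega psi -> ~ Omega x -> psi x = 0.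
Proof.
move=> [_ _ pO] nOx; apply/eqP; apply: contrapT => /negP px.
by apply: nOx; apply: pO; exact: subset_closure.
Qed.

Lemma test_function_bounded psi : test_function Omega psi -> bounded_measurable psi.
Proof.
move=> tp; have cp := test_function_continuous tp.
split; first exact: continuous_bounded_measurable.
have [_ cs _] := tp.
have /compact_bounded[M [_ HM]] : compact (psi @` support_of psi).
  by apply: continuous_compact => //; exact: continuous_subspaceT.
exists (`|M| + 1) => x.
have [sx|nsx] := pselect (support_of psi x).
  by apply: (HM (`|M| + 1)); [rewrite ltr_pwDr// ler_norm|exists x].
rewrite (_ : psi x = 0) ?normr0 ?addr_ge0//.
by apply/eqP; apply: contrapT => /negP px; apply: nsx; exact: subset_closure.
Qed.

Lemma test_function_C1 psi i : test_function Omega psi -> C1_bounded i psi.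
Proof.
move=> tp; have tq := test_function_partial i tp.
split; first exact: test_function_derivable.
  exact: test_function_continuous.
exact: test_function_bounded.
Qed.

Lemma classical_laplacian_lincomb a f g : test_function Omega f -> test_function Omega g ->
  classical_laplacian (a *: f + g) = a *: classical_laplacian f + classical_laplacian g.
Proof.
move=> tf tg; apply/funext => x.
rewrite [RHS](_ : _ = a * classical_laplacian f x + classical_laplacian g x)//.
rewrite /classical_laplacian mulr_sumr -big_split; apply: eq_bigr => i _.
rewrite partial_lincomb; [|exact: test_function_derivable..].
rewrite partial_lincomb//; apply: test_function_derivable; exact: test_function_partial.
Qed.

Lemma laplacian_bounded psi : test_function Omega psi ->
  bounded_measurable (classical_laplacian psi).
Proof.
move=> tp; apply: bounded_measurable_sum => i; apply: test_function_bounded.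
by do 2 apply: test_function_partial.
Qed.

Lemma laplacian_out psi x : test_function Omega psi -> ~ Omega x ->
  classical_laplacian psi x = 0.
Proof.
move=> tp nOx; rewrite /classical_laplacian big1// => i _.
by apply: test_function_out nOx; do 2 apply: test_function_partial.
Qed.

Lemma partialM (i : 'I_n) f g : derivable_along i f -> derivable_along i g ->
  derivable_along i (f * g) /\
  partial i (f * g) = (fun x => f x * partial i g x + g x * partial i f x).
Proof.
move=> df dg; split; first by move=> x; exact: derivableM.
by apply/funext => x; rewrite /partial deriveM.
Qed.

Lemma partial_coord (i : 'I_n) : derivable_along i (fun x : 'rV[R]_n => x ord0 i) /\
  partial i (fun x : 'rV[R]_n => x ord0 i) = cst 1.
Proof.
have E x : is_derive x (delta_mx ord0 i) (fun x : 'rV[R]_n => x ord0 i) 1.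
  have dc : differentiable (fun x : 'rV[R]_n => x ord0 i) x by exact: differentiable_coord.
  apply: DeriveDef; first exact: diff_derivable.
  have E : (fun h : R => h^-1 *: (((fun y : 'rV[R]_n => y ord0 i) \o shift x)
      (h *: delta_mx ord0 i) - x ord0 i)) = (fun h => h^-1 * h).
    by apply/funext => h /=; rewrite !mxE !eqxx mulr1 addrK.
  rewrite /derive E; apply: (@cvg_lim _ (@Rhausdorff R)).
  have c1 : (fun _ : R => 1 : R) @ (0 : R)^' --> (1 : R) by exact: cvg_cst.
  apply: cvg_trans c1; apply: near_eq_cvg; near=> h.
  rewrite mulVf//; near: h; exact: nbhs_dnbhs_neq.
split; first by move=> x; exact: ex_derive.
by apply/funext => x; exact: derive_val.
Unshelve. all: by end_near.
Qed.

End test_function_algebra.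

(** * Integration by parts, Poincare inequality and energy bounds *)

Section energy.
Context {R : realType} {n : nat}.
Variables (B : R) (Omega : set 'rV[R]_n).
Hypotheses (B0 : 0 < B) (OB : forall x, Omega x -> forall i, `|x ord0 i| < B).
Implicit Types psi phi : 'rV[R]_n -> R.
Local Notation cubeI := (cube_integral B).

(** Omega lies strictly inside the cube, so integration by parts of test functions leaves no
    boundary term, whatever the boundary of Omega. *)
Let tf_face psi (i : 'I_n) (x : 'rV[R]_n) : test_function Omega psi -> `|x ord0 i| = B -> psi x = 0.
Proof.
move=> tp xB; apply: test_function_out tp _ => Ox.
by have := OB Ox i; rewrite xB ltxx.
Qed.

Lemma cubeI_by_parts psi phi i : test_function Omega psi -> test_function Omega phi ->
  cubeI (fun x => partial i psi x * phi x) = - cubeI (fun x => psi x * partial i phi x).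
Proof.
move=> tp tq.
have [dM pM] := partialM (test_function_derivable (i := i) tp)
  (test_function_derivable (i := i) tq).
have bp := test_function_bounded tp; have bq := test_function_bounded tq.
have bp' := test_function_bounded (test_function_partial i tp).
have bq' := test_function_bounded (test_function_partial i tq).
have cp := test_function_continuous tp; have cq := test_function_continuous tq.
have cp' := test_function_continuous (test_function_partial i tp).
have cq' := test_function_continuous (test_function_partial i tq).
have b1 := bounded_measurableM bp bq'; have b2 := bounded_measurableM bq bp'.
have : cubeI (partial i (psi * phi)) = 0.
  apply: (cubeI_partial B0); last first.
    move=> x xB; rewrite [LHS](_ : _ = psi x * phi x)//.
    by rewrite (tf_face tp xB) mul0r.
  split; [exact: dM|rewrite pM => x|rewrite pM; exact: bounded_measurableD].
  exact: (cvgD (cvgM (cp x) (cq' x)) (cvgM (cq x) (cp' x))).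
rewrite pM cubeID// => /eqP; rewrite addr_eq0 => /eqP H.
rewrite H opprK; congr cube_integral; by apply/funext => x; rewrite mulrC.
Qed.

(** The derivative of x_i psi^2 along axis i is psi^2 + 2 x_i psi d_i psi and has integral 0. With a
    and b the integrals of psi^2 and (d_i psi)^2, Cauchy-Schwarz and |x_i| <= B give a^2 <= 4 B^2 a
    b. *)
Lemma poincare psi i : test_function Omega psi ->
  cubeI (fun x => psi x ^+ 2) <= 4 * B ^+ 2 * cubeI (fun x => partial i psi x ^+ 2).
Proof.
move=> tp; pose c := (fun x : 'rV[R]_n => x ord0 i).
have [dc pc] := @partial_coord R n i.
have dp := test_function_derivable (i := i) tp.
have [d2 p2] := partialM dp dp.
have [d3 p3] := partialM dc d2.
have bp := test_function_bounded tp.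
have bp' := test_function_bounded (test_function_partial i tp).
have cp := test_function_continuous tp.
have cp' := test_function_continuous (test_function_partial i tp).
have cc : continuous c by move=> x; exact: coord_continuous.
(* The coordinate alone is unbounded on R^n; the product is bounded because psi vanishes off
   Omega. *)
have bc : bounded_measurable (fun x => c x * psi x).
  split; first by apply: measurable_funM; [exact: measurable_coor|case: bp].
  have [_ [M HM]] := bp; exists (B * M) => x; rewrite normrM.
  have [Ox|nOx] := pselect (Omega x); first by apply: ler_pM => //; exact: ltW (OB Ox i).
  rewrite (test_function_out tp nOx) normr0 mulr0 mulr_ge0 ?(ltW B0)//.
  exact: le_trans (HM 0).
have b2 := bounded_measurableX bp.
have b3 := bounded_measurableM bc bp'.
pose F := (fun x : 'rV[R]_n => x ord0 i) * (psi * psi).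
have pF : partial i F = fun x => 2 * (c x * psi x * partial i psi x) + psi x ^+ 2.
  rewrite p3 p2 pc; apply/funext => x; rewrite [X in X * cst 1 x](_ : _ = psi x * psi x)//.
  by rewrite /c /cst/=; ring.
have cF : continuous (fun x => 2 * (c x * psi x * partial i psi x) + psi x * psi x).
  by move=> x; exact: (cvgD (cvgM (cvg_cst _) (cvgM (cvgM (cc x) (cp x)) (cp' x)))
    (cvgM (cp x) (cp x))).
have : cubeI (partial i F) = 0.
  apply: (cubeI_partial B0); last first.
    move=> x xB; rewrite [LHS](_ : _ = x ord0 i * (psi x * psi x))//.
    by rewrite (tf_face tp xB) !mulr0.
  split; [exact: d3|rewrite pF => x|rewrite pF]; last first.
    by apply: bounded_measurableD => //; exact: bounded_measurableZ.
  exact: cF.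
rewrite pF cubeID//; last exact: bounded_measurableZ.
rewrite cubeIZ//.
have := cubeI_cauchy_schwarz B bc bp'.
have : cubeI (fun x => (c x * psi x) ^+ 2) <= B ^+ 2 * cubeI (fun x => psi x ^+ 2).
  rewrite -cubeIZ//; apply: cubeI_le; [exact: bounded_measurableX|exact: bounded_measurableZ|].
  move=> x cx; rewrite exprMn ler_wpM2r ?sqr_ge0//.
  rewrite -real_normK ?num_real// ler_sqr ?nnegrE ?(ltW B0)//.
  by have := cx i; rewrite in_itv/= -ler_norml.
have : 0 <= cubeI (fun x => psi x ^+ 2) by apply: cubeI_ge0 => x; exact: sqr_ge0.
have : 0 <= cubeI (fun x => partial i psi x ^+ 2) by apply: cubeI_ge0 => x; exact: sqr_ge0.
move: (cubeI (fun x => psi x ^+ 2)) (cubeI (fun x => partial i psi x ^+ 2))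
  (cubeI (fun x => (c x * psi x) ^+ 2)) (cubeI (fun x => c x * psi x * partial i psi x)).
move=> a b s r b0 a0 sa rs e.
have [->|an0] := eqVneq a 0; first by rewrite mulr_ge0// mulr_ge0// sqr_ge0.
have ap : 0 < a by rewrite lt_def an0.
rewrite -(ler_pM2l ap).
have ar : a = - (2 * r) by lra.
have -> : a * a = 4 * r ^+ 2 by rewrite ar; ring.
apply: (@le_trans _ _ (4 * (s * b))); first by rewrite ler_pM2l.
have -> : a * (4 * B ^+ 2 * b) = 4 * (B ^+ 2 * a * b) by ring.
by rewrite ler_pM2l// ler_wpM2r.
Qed.

Lemma cubeI_sum (I : finType) (f : I -> 'rV[R]_n -> R) : (forall i, bounded_measurable (f i)) ->
  cubeI (fun x => \sum_i f i x) = \sum_i cubeI (f i).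
Proof.
move=> bf; have H (s : seq I) : bounded_measurable (fun x => \sum_(i <- s) f i x) /\
    cubeI (fun x => \sum_(i <- s) f i x) = \sum_(i <- s) cubeI (f i).
  elim: s => [|i s [bs IH]].
    rewrite big_nil; under eq_fun do rewrite big_nil.
    split; first exact: bounded_measurable_cst.
    by rewrite cubeI_cst mul0r.
  rewrite big_cons; under eq_fun do rewrite big_cons.
  by split; [exact: bounded_measurableD|rewrite cubeID// IH].
by have [_ ] := H (index_enum I).
Qed.

Lemma dirichlet_integralE psi : test_function Omega psi ->
  \sum_i cubeI (fun x => partial i psi x ^+ 2) =
  - cubeI (fun x => psi x * classical_laplacian psi x).
Proof.
move=> tp; have t2 i := test_function_partial i (test_function_partial i tp).
have b2 i := bounded_measurableM (test_function_bounded tp) (test_function_bounded (t2 i)).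
under [in RHS]eq_fun do rewrite mulr_sumr.
rewrite cubeI_sum// -sumrN; apply: eq_bigr => i _.
by rewrite -cubeI_by_parts//; exact: test_function_partial.
Qed.

(* Both bounds come from |grad psi|^2 = - <psi, Lap psi> combined with the
   Poincare inequality in the direction i. *)
Lemma energy_le psi (i : 'I_n) : test_function Omega psi ->
  let c := cubeI (fun x => classical_laplacian psi x ^+ 2) in
  \sum_j cubeI (fun x => partial j psi x ^+ 2) <= 4 * B ^+ 2 * c /\
  cubeI (fun x => psi x ^+ 2) <= 16 * B ^+ 4 * c.
Proof.
move=> tp c.
have c0 : 0 <= c by apply: cubeI_ge0 => x; exact: sqr_ge0.
have D := dirichlet_integralE tp.
have S := cubeI_cauchy_schwarz B (test_function_bounded tp) (laplacian_bounded tp).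
have p0 j : 0 <= cubeI (fun x => partial j psi x ^+ 2) by apply: cubeI_ge0 => x; exact: sqr_ge0.
have P : cubeI (fun x => psi x ^+ 2) <= 4 * B ^+ 2 * \sum_j cubeI (fun x => partial j psi x ^+ 2).
  apply: le_trans (poincare i tp) _; apply: ler_wpM2l.
    by rewrite mulr_ge0// sqr_ge0.
  by rewrite (bigD1 i)//= lerDl; exact: sumr_ge0.
have b0 : 0 <= \sum_j cubeI (fun x => partial j psi x ^+ 2) by exact: sumr_ge0.
rewrite -/c -sqrrN -D in S.
(* With a, b, c the integrals of psi^2, |grad psi|^2 and (Delta psi)^2: from b^2 <= a c and a <= 4
   B^2 b follow b <= 4 B^2 c and a <= 16 B^4 c. *)
move: b0 P S; move: (\sum_j _) (cubeI (fun x => psi x ^+ 2)) => b a b0 P S.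
have B2 : 0 <= 4 * B ^+ 2 by rewrite mulr_ge0// sqr_ge0.
have H : b <= 4 * B ^+ 2 * c.
  have [->|bn0] := eqVneq b 0; first by rewrite mulr_ge0.
  have bp : 0 < b by rewrite lt_def bn0.
  rewrite -(ler_pM2l bp) -expr2; apply: le_trans S _.
  apply: le_trans (ler_wpM2r c0 P) _.
  by rewrite le_eqVlt; apply/orP; left; apply/eqP; ring.
split=> //; apply: le_trans P _; apply: le_trans (ler_wpM2l B2 H) _.
by rewrite le_eqVlt; apply/orP; left; apply/eqP; ring.
Qed.

End energy.

(** * Compactness *)

Section ultrafilter.
Context {R : realType}.
Variable U : set_system nat.
Hypothesis UU : UltraFilter U.

(** By compactness the image of U has a cluster point. U contains the preimage of a ball around it
    or the complement of that preimage, and the latter would contradict clustering. *)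
Lemma ultra_bounded_cauchy (x : nat -> R) K e : (forall n, `|x n| <= K) -> 0 < e ->
  exists2 A, U A & forall m n, A m -> A n -> `|x m - x n| <= e.
Proof.
move=> xK e0.
have cK : compact `[- K, K]%classic by exact: segment_compact.
have UK : (x @ U) `[- K, K]%classic.
  apply: (@filterS _ U _ setT); last exact: filterT.
  by move=> k _; rewrite /= in_itv/= -ler_norml; exact: xK.
have [p [_ clp]] := cK _ _ UK.
exists (x @^-1` ball p (e / 2)); last first.
  move=> m n /=; rewrite /ball/= => pm pn.
  rewrite (_ : x m - x n = (p - x n) - (p - x m)); last by ring.
  by apply: le_trans (ler_normB _ _) _; lra.
have [//|nU] := in_ultra_setVsetC (x @^-1` ball p (e / 2)) UU.
have e2 : 0 < e / 2 by rewrite divr_gt0.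
have [y [/= ny yb]] := clp (~` ball p (e / 2)) (ball p (e / 2)) nU (nbhsx_ballx p _ e2).
by case: ny.
Qed.

Hypothesis Uoo : \oo `<=` U.

(** Finite intersections of the sets A_k are in U and, since U refines [\oo], have arbitrarily large
    elements. The k-th index is taken in the k-th intersection, beyond the previous one. *)
Lemma ultra_extract (d : nat -> nat -> R) :
  (forall e, 0 < e -> exists2 A, U A & forall m n, A m -> A n -> d m n <= e) ->
  exists2 s : nat -> nat, {homo s : m n / (m < n)%N} &
    forall e, 0 < e -> exists N, forall m n, (N <= m)%N -> (N <= n)%N -> d (s m) (s n) <= e.
Proof.
move=> H.
have /choice[A AP] (k : nat) : exists A, U A /\ forall m n, A m -> A n -> d m n <= k.+1%:R^-1.
  by have [|A UA AP] := H (k.+1%:R^-1); [rewrite invr_gt0 ltr0n|exists A].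
pose I k := \bigcap_(j in `I_k.+1) A j.
have UI k : U (I k).
  rewrite /I bigcap_mkord; elim: k.+1 => [|j IH]; first by rewrite big_ord0; exact: filterT.
  by rewrite big_ord_recr/=; apply: filterI => //; case: (AP j).
have /choice[nx nxP] (kn : nat * nat) : exists m, I kn.1 m /\ (kn.2 < m)%N.
  have : U (I kn.1 `&` [set m | (kn.2 < m)%N]).
    by apply: filterI => //; apply: Uoo; exact: nbhs_infty_gt.
  by move=> /filter_ex[m [Im /= lm]]; exists m.
pose s := fix s k := if k is k'.+1 then nx (k, s k') else nx (0%N, 0%N).
have sI k : I k (s k) by case: k => [|k] /=; [have [] := nxP (0, 0)%N|have [] := nxP (k.+1, s k)].
exists s.
  by apply: homo_ltn => [|k /=]; [exact: ltn_trans|have [] := nxP (k.+1, s k)].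
move=> e e0; have [N _ HN] := near_infty_natSinv_lt (PosNum e0).
exists N => m n Nm Nn; apply: le_trans (ltW (HN N (leqnn N))).
by apply: (AP N).2; apply: sI; rewrite /= ltnS.
Qed.

End ultrafilter.

Section rellich.
Context {R : realType} {n : nat}.
Variables (B : R) (Omega : set 'rV[R]_n).
Hypotheses (B0 : 0 < B) (OB : forall x, Omega x -> forall i, `|x ord0 i| < B).
Local Notation cubeI := (cube_integral B).

Let tfB f g : test_function Omega f -> test_function Omega g -> test_function Omega (f - g).
Proof. by move=> tf tg; rewrite addrC -scaleN1r; exact: test_function_lincomb. Qed.

Let cubeI_sqrB_le (f g : 'rV[R]_n -> R) : bounded_measurable f -> bounded_measurable g ->
  cubeI (fun x => (f - g) x ^+ 2) <=
    2 * cubeI (fun x => f x ^+ 2) + 2 * cubeI (fun x => g x ^+ 2).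
Proof.
move=> bf bg; have bf2 := bounded_measurableX bf; have bg2 := bounded_measurableX bg.
rewrite -(cubeIZ B 2 bf2) -(cubeIZ B 2 bg2) -cubeID; [|exact: bounded_measurableZ..].
apply: cubeI_le.
- by apply: bounded_measurableX; exact: bounded_measurableB.
- by apply: bounded_measurableD; exact: bounded_measurableZ.
move=> x _; have := sqr_ge0 (f x + g x); rewrite [(f - g) x](_ : _ = f x - g x)//.
by move: (f x) (g x) => a b; nra.
Qed.

Lemma rellich (U : set_system nat) (psi : nat -> 'rV[R]_n -> R) (i0 : 'I_n) K :
  UltraFilter U -> (forall k, test_function Omega (psi k)) ->
  (forall k, cubeI (fun x => classical_laplacian (psi k) x ^+ 2) <= K) ->
  forall e, 0 < e -> exists2 A, U A & forall k l, A k -> A l ->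
    cubeI (fun x => (psi k x - psi l x) ^+ 2) <= e.
Proof.
move=> UU tp cK e e0.
have lapB k l : cubeI (fun x => classical_laplacian (psi k - psi l) x ^+ 2) <= 4 * K.
  have bk := laplacian_bounded (tp k); have bl := laplacian_bounded (tp l).
  have -> : classical_laplacian (psi k - psi l) =
      classical_laplacian (psi k) - classical_laplacian (psi l).
    by rewrite addrC -scaleN1r (classical_laplacian_lincomb (-1) (tp l) (tp k)) scaleN1r addrC.
  apply: le_trans (cubeI_sqrB_le bk bl) _.
  have -> : 4 * K = 2 * K + 2 * K by ring.
  by apply: lerD; apply: ler_wpM2l => //; exact: cK.
have K0 : 0 <= K by apply: le_trans (cK 0%N); apply: cubeI_ge0 => x; exact: sqr_ge0.
pose K1 := 4 * B ^+ 2 * (4 * K).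
have K10 : 0 <= K1 by apply: mulr_ge0; apply: mulr_ge0 => //; exact: sqr_ge0.
(* The small parameter for [ehrling]: times [K1], which bounds the Dirichlet integral of any psi_k -
   psi_l, it is at most e / 2. The + 1 covers K1 = 0. *)
have e1 : 0 < e / (2 * (K1 + 1)) by rewrite divr_gt0//; lra.
have [I [w [C [C0 bw H]]]] := ehrling B0 n e1.
(* [m] fixes [dl] so that functionals of size at most [dl] contribute C #|I| dl^2 <= e / 2. *)
pose m : R := C * #|I|%:R + 1.
have m0 : 0 < m by rewrite ltr_wpDl// mulr_ge0.
pose dl := Num.sqrt (e / (2 * m)).
have dl0 : 0 < dl by rewrite sqrtr_gt0 divr_gt0// mulr_gt0.
have /choice[A AP] i : exists A, U A /\ forall k l, A k -> A l ->
    `|cubeI (fun x => psi k x * w i x) - cubeI (fun x => psi l x * w i x)| <= dl.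
  (* A bound uniform in k, from Cauchy-Schwarz and the second bound of [energy_le]. *)
  pose M := Num.sqrt (16 * B ^+ 4 * K * cubeI (fun x => w i x ^+ 2)).
  have [k|A UA HA] := @ultra_bounded_cauchy _ _ UU
    (fun k => cubeI (fun x => psi k x * w i x)) M dl _ dl0.
    rewrite -sqrtr_sqr ler_wsqrtr//.
    apply: le_trans (cubeI_cauchy_schwarz B (test_function_bounded (tp k)) (bw i)) _.
    apply: ler_wpM2r; first by apply: cubeI_ge0 => x; exact: sqr_ge0.
    have [_ E] := energy_le B0 OB i0 (tp k).
    apply: le_trans E _; apply: ler_wpM2l => //.
    by rewrite mulr_ge0// exprn_ge0// ltW.
  by exists A.
exists [set k | forall i, A i k].
  by apply: filter_forall => i; case: (AP i).
move=> k l Ak Al; have tkl := tfB (tp k) (tp l).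
apply: le_trans (H _ (test_function_bounded tkl) (fun j => test_function_C1 j tkl)) _.
have [E _] := energy_le B0 OB i0 tkl.
have E1 : \sum_j cubeI (fun x => partial j (psi k - psi l) x ^+ 2) <= K1.
  apply: le_trans E _; apply: ler_wpM2l; last exact: lapB.
  by rewrite mulr_ge0// sqr_ge0.
have h1 : e / (2 * (K1 + 1)) * \sum_j cubeI (fun x => partial j (psi k - psi l) x ^+ 2) <= e / 2.
  apply: le_trans (ler_wpM2l (ltW e1) E1) _.
  have -> : e / (2 * (K1 + 1)) * K1 = e / 2 * (K1 / (K1 + 1)) by field; lra.
  rewrite ler_piMr//; first lra.
  by rewrite ler_pdivrMr; lra.
have h2 : C * \sum_i cubeI (fun x => (psi k - psi l) x * w i x) ^+ 2 <= e / 2.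
  apply: (@le_trans _ _ (C * \sum_(i : I) dl ^+ 2)).
    apply: ler_wpM2l => //; apply: ler_sum => i _.
    have -> : cubeI (fun x => (psi k - psi l) x * w i x) =
        cubeI (fun x => psi k x * w i x) - cubeI (fun x => psi l x * w i x).
      have bk := bounded_measurableM (test_function_bounded (tp k)) (bw i).
      have bl := bounded_measurableM (test_function_bounded (tp l)) (bw i).
      rewrite -[in RHS]mulN1r -(cubeIZ B (-1) bl) -cubeID//; last exact: bounded_measurableZ.
      congr cube_integral; apply/funext => x.
      transitivity ((psi k x - psi l x) * w i x) => //; ring.
    rewrite -real_normK ?num_real// ler_sqr ?nnegrE ?(ltW dl0)//.
    by apply: (AP i).2.
  rewrite sumr_const /dl sqr_sqrtr; last first.
    by apply: divr_ge0; [exact: ltW|apply: mulr_ge0 => //; exact: ltW].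
  rewrite -[_ *+ #|_|]mulr_natl mulrA.
  have -> : C * #|I|%:R * (e / (2 * m)) = e / 2 * (C * #|I|%:R / m) by field; lra.
  rewrite ler_piMr//; first lra.
  by rewrite ler_pdivrMr// mul1r /m lerDl.
by apply: le_trans (lerD h2 h1) _; lra.
Qed.

End rellich.

(** * L^2(Omega) in terms of integrals of squares *)

Section L2.
Context {R : realType} {n : nat}.
Variable Omega : set 'rV[R]_n.
Variable oOmega : open Omega.
Local Notation mu := (lebesgue_on oOmega).
Local Notation L2 := (L2 oOmega).
Local Notation L2_norm := (L2_norm oOmega).
Local Notation L2_dot := (L2_dot oOmega).
Implicit Types f g h : 'rV[R]_n -> R.

Let Lnorm2_sqr f : measurable_fun setT f ->
  ('N[mu]_2%:E[EFin \o f] `^ 2 = \int[mu]_x (f x ^+ 2)%:E)%E.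
Proof.
move=> mf; rewrite powR_Lnorm//.
by apply: eq_integral => x _; rewrite /= powR_mulrn// real_normK// num_real.
Qed.

Lemma L2_sqint f : L2 f <-> sqint mu setT f.
Proof.
split=> [Lf|[mf If]].
  split; last exact: Lfun2_integrable_sqr Lf.
  by move: Lf => /andP[]; rewrite inE.
apply/andP; split; rewrite inE//= /finite_norm; apply: (@lty_poweRy _ _ 2) => //.
rewrite Lnorm2_sqr//; have /integrableP[_] := If.
by under eq_integral do rewrite /= ger0_norm ?sqr_ge0//.
Qed.

Lemma L2_norm_ge0 f : 0 <= L2_norm f.
Proof. by apply: fine_ge0; exact: Lnorm_ge0. Qed.

Lemma L2_normE f : L2 f -> L2_norm f ^+ 2 = L2_dot f f.
Proof.
move=> Lf; have [mf _] := (L2_sqint f).1 Lf.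
apply: EFin_inj; rewrite [RHS](inner_normE measurableT ((L2_sqint f).1 Lf)).
rewrite -Lnorm2_sqr// /L2_norm.
have Nf : ('N[mu]_2%:E[EFin \o f] \is a fin_num)%E.
  rewrite ge0_fin_numE ?Lnorm_ge0//.
  by move: Lf => /andP[_]; rewrite inE.
by rewrite -[in RHS](fineK Nf) poweR_EFin powR_mulrn// fine_ge0// Lnorm_ge0.
Qed.

(** A product that vanishes off Omega has the same integral over Omega, the cube and the whole
    space. This transfers the calculus on the cube to pairings over Omega in which one factor
    vanishes off Omega. *)
Lemma L2_dot_cubeI B f g : (forall x, Omega x -> cube B x) ->
  (forall x, ~ Omega x -> f x * g x = 0) -> L2_dot f g = cube_integral B (fun x => f x * g x).
Proof.
move=> OC fg0; have mO := open_measurable_rV oOmega.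
have patchO (D : set 'rV[R]_n) : Omega `<=` D ->
    (fun x => (f x * g x)%:E) \_ D = (fun x => (f x * g x)%:E).
  move=> OD; apply/funext => x; rewrite patchE; case: ifPn => //.
  by move=> /negP xD; rewrite fg0// => /OD Dx; apply: xD; rewrite inE.
rewrite /Defs.L2_dot /cube_integral /Rintegral; congr fine.
rewrite [RHS]integral_mkcond patchO// -[in RHS](patchO Omega)// -[RHS]integral_mkcond.
rewrite -[in LHS](patchO Omega)// -[LHS]integral_mkcond.
apply: eq_measure_integral => A mA AO.
by rewrite [LHS]/(lebesgue_rV n (A `&` Omega)) (setIidl AO).
Qed.

Lemma lebesgue_on_fin B : (forall x, Omega x -> cube B x) -> (mu setT < +oo)%E.
Proof.
move=> OC; apply: le_lt_trans (cube_fin B n).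
rewrite [leLHS]/(lebesgue_rV n (setT `&` Omega)) setTI.
by apply: le_measure => //; rewrite inE; [exact: open_measurable_rV|exact: measurable_cube].
Qed.

End L2.

(** * Density of Laplacians of test functions and the duality argument *)

Section compactness.
Context {R : realType} {n : nat}.
Variable Omega : set 'rV[R]_n.
Variables (oOmega : open Omega) (B : R).
Hypotheses (B0 : 0 < B) (OB : forall x, Omega x -> forall i, `|x ord0 i| < B).
Local Notation mu := (lebesgue_on oOmega).
Local Notation L2 := (L2 oOmega).
Local Notation L2_norm := (L2_norm oOmega).
Local Notation L2_dot := (L2_dot oOmega).

Let OC x : Omega x -> cube B x.
Proof. by move=> Ox i; rewrite in_itv/= -ler_norml; exact: ltW (OB Ox i). Qed.

Let fmu := lebesgue_on_fin oOmega OC.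

Let bm_L2 f : bounded_measurable f -> sqint mu setT f.
Proof. exact: bounded_measurable_sqint. Qed.

Let sqintB f g : sqint mu setT f -> sqint mu setT g -> sqint mu setT (f - g).
Proof. by move=> Lf Lg; rewrite addrC -scaleN1r; exact: sqintP. Qed.

Let dotB f g h : sqint mu setT f -> sqint mu setT g -> sqint mu setT h ->
  L2_dot (f - g) h = L2_dot f h - L2_dot g h.
Proof.
move=> Lf Lg Lh; rewrite addrC -scaleN1r [LHS](innerP measurableT (-1) Lg Lf Lh).
by rewrite mulN1r addrC.
Qed.

Let dotD f g h : sqint mu setT f -> sqint mu setT g -> sqint mu setT h ->
  L2_dot (f + g) h = L2_dot f h + L2_dot g h.
Proof.
by move=> Lf Lg Lh; rewrite -[f]scale1r [LHS](innerP measurableT 1 Lf Lg Lh) mul1r scale1r.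
Qed.

Let dotC f g : L2_dot f g = L2_dot g f.
Proof. exact: (innerC mu setT). Qed.

Let dot_sqrB_le f g : sqint mu setT f -> sqint mu setT g ->
  L2_dot (f - g) (f - g) <= 2 * L2_dot f f + 2 * L2_dot g g.
Proof.
apply: (@dot_sqrB_le _ _ (sqint mu setT) (inner mu setT)).
- by move=> a u v; exact: sqintP.
- exact: innerC.
- by move=> a u v w; exact: innerP.
- exact: inner_ge0.
Qed.

Lemma laplacian_approx f e : L2_orthogonal oOmega (Defs.harmonic oOmega) f -> 0 < e ->
  exists2 psi, test_function Omega psi &
    L2_dot (f - classical_laplacian psi) (f - classical_laplacian psi) <= e.
Proof.
move=> [Lf f_orth] e0.
pose W := [set classical_laplacian psi | psi in test_function Omega].
have WL : W `<=` sqint mu setT.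
  by move=> _ [psi tp <-]; apply: bm_L2; exact: laplacian_bounded tp.
have lap0 : classical_laplacian (0 : 'rV[R]_n -> R) = 0.
  have := classical_laplacian_lincomb (-1) (test_function0 Omega) (test_function0 Omega).
  by rewrite scaler0 addr0 scaleN1r addNr.
have W0 : W 0 by exists 0 => //; exact: test_function0.
have WP a u v : W u -> W v -> W (a *: u + v).
  move=> [p tp <-] [q tq <-]; exists (a *: p + q); first exact: test_function_lincomb.
  exact: classical_laplacian_lincomb tp tq.
have [] := @approx_of_bi_orthogonal _ _ (sqint mu setT) (inner mu setT) (sqint0 mu setT)
  (fun a u v => @sqintP _ _ _ mu setT measurableT a u v) (innerC mu setT)
  (fun a u v w => @innerP _ _ _ mu setT measurableT a u v w) (inner_ge0 mu setT)
  (L2_complete fmu) W f WL W0 WP ((L2_sqint oOmega f).1 Lf) _ e e0.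
- move=> h Lh hW; apply: f_orth; split; first exact/L2_sqint.
  move=> psi tp; rewrite [LHS]hW; last by exists psi.
  rewrite [RHS](_ : _ = inner mu setT 0 psi)//.
  have Lp := bm_L2 (test_function_bounded tp).
  have := dotB Lp Lp Lp; rewrite !subrr => H.
  by rewrite -[RHS]/(L2_dot 0 psi) H.
- by move=> _ [psi tp <-] H; exists psi.
Qed.

Let dot_cauchy_schwarz f g : sqint mu setT f -> sqint mu setT g ->
  L2_dot f g ^+ 2 <= L2_dot f f * L2_dot g g.
Proof. exact: inner_cauchy_schwarz. Qed.

Let dot_test psi phi : bounded_measurable psi -> (forall x, ~ Omega x -> phi x = 0) ->
  L2_dot psi phi = cube_integral B (fun x => psi x * phi x).
Proof. by move=> _ p0; apply: L2_dot_cubeI => // x /p0 ->; rewrite mulr0. Qed.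

Lemma H_laplacian_tilde_cauchy (U : set_system nat) (i0 : 'I_n) (u : nat -> 'rV[R]_n -> R) M :
  UltraFilter U -> \oo `<=` U -> (forall k, H_laplacian_tilde oOmega (u k)) ->
  (forall k, L2_dot (u k) (u k) <= M) ->
  (forall k, L2_dot (laplacian oOmega (u k)) (laplacian oOmega (u k)) <= M) ->
  forall e, 0 < e -> exists2 A, U A & forall k l, A k -> A l ->
    L2_dot (u k - u l) (u k - u l) <= e.
Proof.
move=> UU Uoo uH uM gM e e0.
have M0 : 0 <= M by apply: le_trans (uM 0%N); exact: inner_ge0.
pose g k := laplacian oOmega (u k).
have gP k : L2 (g k) /\ is_laplacian oOmega (u k) (g k).
  by have [[_ Hu] _] := uH k; exact: (xgetPex (fun=> 0) Hu).
have Lg k : sqint mu setT (g k) by apply/L2_sqint; case: (gP k).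
have Lu k : sqint mu setT (u k) by apply/L2_sqint; case: (uH k) => [[]].
have inv0 k : 0 < (k.+1%:R^-1 : R) by rewrite invr_gt0 ltr0n.
have /choice[psi psiP] k : exists psi, test_function Omega psi /\
    L2_dot (u k - classical_laplacian psi) (u k - classical_laplacian psi) <= k.+1%:R^-1.
  by have [psi tp H] := laplacian_approx (uH k).2 (inv0 k); exists psi.
have tp k : test_function Omega (psi k) by case: (psiP k).
pose L k := classical_laplacian (psi k).
have LL k : sqint mu setT (L k) by apply: bm_L2; exact: laplacian_bounded (tp k).
have Lr k : sqint mu setT (u k - L k) by exact: sqintB.
have rE k : L2_dot (u k - L k) (u k - L k) <= k.+1%:R^-1 by case: (psiP k).
(* Delta psi_k is u_k minus an error of squared norm at most 1/(k+1) <= 1. *)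
have cK k : cube_integral B (fun x => L k x ^+ 2) <= 2 * M + 2.
  rewrite (_ : cube_integral B _ = L2_dot (L k) (L k)); last first.
    rewrite (dot_test (laplacian_bounded (tp k)))//.
    by move=> x nOx; exact: laplacian_out (tp k) nOx.
  have -> : L k = u k - (u k - L k) by rewrite opprB addrC subrK.
  apply: le_trans (dot_sqrB_le (Lu k) (Lr k)) _.
  apply: lerD; first by apply: ler_wpM2l.
  rewrite -[leRHS]mulr1; apply: ler_wpM2l => //; apply: le_trans (rE k) _.
  by rewrite invf_le1// ler1n.
(* Chosen so that 4 M d <= (e / 2)^2: by Cauchy-Schwarz, vectors of squared norms at most 4 M and d
   have inner product at most e / 2. *)
pose d := e ^+ 2 / (16 * (M + 1)).
have d0 : 0 < d by rewrite divr_gt0 ?exprn_gt0//; lra.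
have [A UA AP] := rellich B0 OB i0 UU tp cK d0.
(* From N on, each error has squared norm at most d / 4, so a difference of two has at most 2 (d /
   4) + 2 (d / 4) = d. *)
have [N _ HN] := near_infty_natSinv_lt (PosNum (divr_gt0 d0 (ltr0n R 4 : 0 < 4))).
exists (A `&` [set k | (N <= k)%N]).
  by apply: filterI => //; apply: Uoo; exact: nbhs_infty_ge.
move=> k l [Ak Nk] [Al Nl].
pose x := u k - u l; have Lx : sqint mu setT x by exact: sqintB.
pose f := psi k - psi l.
have Lf : sqint mu setT f.
  by apply: sqintB; apply: bm_L2; exact: test_function_bounded (tp _).
have xM : L2_dot x x <= 4 * M.
  apply: le_trans (dot_sqrB_le (Lu k) (Lu l)) _.
  have -> : 4 * M = 2 * M + 2 * M by ring.
  by apply: lerD; apply: ler_wpM2l.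
have gxM : L2_dot (g k - g l) (g k - g l) <= 4 * M.
  apply: le_trans (dot_sqrB_le (Lg k) (Lg l)) _.
  have -> : 4 * M = 2 * M + 2 * M by ring.
  by apply: lerD; apply: ler_wpM2l => //; exact: gM.
have fd : L2_dot f f <= d.
  rewrite dot_test; last first.
  - move=> y nOy; rewrite [LHS](_ : _ = psi k y - psi l y)//.
    by rewrite !(test_function_out (tp _) nOy) subrr.
  - by apply: bounded_measurableB; exact: test_function_bounded (tp _).
  exact: AP.
have rd : L2_dot ((u k - L k) - (u l - L l)) ((u k - L k) - (u l - L l)) <= d.
  apply: le_trans (dot_sqrB_le (Lr k) (Lr l)) _.
  have Hk := le_trans (rE k) (ltW (HN _ Nk)); have Hl := le_trans (rE l) (ltW (HN _ Nl)).
  rewrite /= in Hk Hl.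
  have -> : d = 2 * (d / 4) + 2 * (d / 4) by field.
  by apply: lerD; (apply: ler_wpM2l; first by []); [exact: Hk|exact: Hl].
(* The definition of the distributional Laplacian, tested with psi_k - psi_l. *)
have fE : L2_dot x (L k - L l) = L2_dot (g k - g l) f.
  have tf : test_function Omega f.
    by rewrite /f addrC -scaleN1r; exact: test_function_lincomb.
  have -> : L k - L l = classical_laplacian f.
    rewrite /f; apply/esym; rewrite addrC -scaleN1r.
    by rewrite (classical_laplacian_lincomb (-1) (tp l) (tp k)) scaleN1r addrC.
  have Llf : sqint mu setT (classical_laplacian f) by apply: bm_L2; exact: laplacian_bounded tf.
  by rewrite /x !dotB// (gP k).2// (gP l).2.
have LrB : sqint mu setT ((u k - L k) - (u l - L l)) by exact: sqintB.
have LLB : sqint mu setT (L k - L l) by exact: sqintB.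
have -> : L2_dot x x = L2_dot x ((u k - L k) - (u l - L l)) + L2_dot (g k - g l) f.
  have xE : x = (u k - L k - (u l - L l)) + (L k - L l).
    by rewrite opprB addrACA subrK [L l - _]addrC addrK.
  by rewrite -fE {1}xE dotD//; congr (_ + _); exact: dotC.
have h (a b : 'rV[R]_n -> R) : sqint mu setT a -> sqint mu setT b ->
    L2_dot a a <= 4 * M -> L2_dot b b <= d -> L2_dot a b <= e / 2.
  move=> La Lb aM bd; apply: le_trans (ler_norm _) _.
  have e20 : 0 <= e / 2 by rewrite divr_ge0// ltW.
  rewrite -ler_sqr ?nnegrE// real_normK ?num_real//.
  apply: le_trans (dot_cauchy_schwarz La Lb) _.
  apply: (@le_trans _ _ (4 * M * d)).
    by apply: ler_pM => //; exact: inner_ge0.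
  rewrite /d.
  have -> : 4 * M * (e ^+ 2 / (16 * (M + 1))) = (e / 2) ^+ 2 * (M / (M + 1)) by field; lra.
  rewrite ler_piMr ?sqr_ge0//.
  by rewrite ler_pdivrMr; lra.
have e2 : e = e / 2 + e / 2 by field.
rewrite e2; apply: lerD; first exact: h.
by apply: h => //; exact: sqintB.
Qed.

End compactness.

Theorem theorem2p12 (R : realType) (N : nat) (Omega : set 'rV[R]_N)
    (oOmega : open Omega) (cOmega : connected Omega) (neOmega : Omega !=set0)
    (bOmega : bounded_set Omega) :
  compact_embedding (H_laplacian_tilde oOmega) (graph_norm oOmega)
    (L2 oOmega) (L2_norm oOmega).
Proof.
split=> [f [[]]//|u uH [M HM]].
have Lu k : L2 oOmega (u k) by case: (uH k) => [[]].
have [B B0 OB] : exists2 B : R, 0 < B & forall x, Omega x -> forall i, `|x ord0 i| < B.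
  have [K [_ HK]] := bOmega.
  (* The norm of row vectors is the maximum norm, bounded on Omega by any number above K, here |K| +
     1; one more unit makes the coordinate bounds strict. *)
  exists (`|K| + 2) => [|x Ox i]; first by rewrite ltr_wpDl.
  have /= xK : `|x| <= `|K| + 1 by apply: HK => //; rewrite ltr_pwDr// ler_norm.
  apply: le_lt_trans (le_trans _ xK) _; last by rewrite ltrD2l ltr1n.
  rewrite [leRHS]mx_normrE; exact: (le_bigmax _ (fun ij => `|x ij.1 ij.2|) (ord0, i)).
have OC x : Omega x -> cube B x.
  by move=> Ox i; rewrite in_itv/= -ler_norml; exact: ltW (OB _ Ox i).
have fmu := lebesgue_on_fin oOmega OC.
(* By completeness it is enough to find a subsequence that is Cauchy for squared distances. *)
have cauchy (s : nat -> nat) : {homo s : m n / (m < n)%N} ->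
    (forall e, 0 < e -> exists N, forall m n, (N <= m)%N -> (N <= n)%N ->
      L2_dot oOmega (u (s m) - u (s n)) (u (s m) - u (s n)) <= e) ->
    exists s : nat -> nat, {homo s : m n / (m < n)%N} /\
      exists2 l, L2 oOmega l & (fun n => L2_norm oOmega (u (s n) - l)) @ \oo --> (0 : R).
  move=> hs cs; exists s; split => //.
  have Ls k : sqint (lebesgue_on oOmega) setT (u (s k)) by exact/L2_sqint.
  have [l Ll Hl] := L2_complete fmu Ls cs.
  exists l; first exact/L2_sqint.
  apply/cvgrPdist_le => e e0; have [K HK] := Hl _ (exprn_gt0 2 e0).
  exists K => // k Kk /=; rewrite sub0r normrN ger0_norm ?L2_norm_ge0//.
  rewrite -ler_sqr ?nnegrE ?L2_norm_ge0 ?(ltW e0)// L2_normE; first exact: HK.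
  by apply/L2_sqint; rewrite addrC -scaleN1r; exact: sqintP.
have dM k : L2_dot oOmega (u k) (u k) <= M ^+ 2 /\
    L2_dot oOmega (laplacian oOmega (u k)) (laplacian oOmega (u k)) <= M ^+ 2.
  (* Membership in [H_laplacian] rules out the default value of [laplacian], so it is square
     integrable and the graph norm bounds both terms. *)
  have [[_ Hu] _] := uH k; have [Lg _] := xgetPex (fun=> 0) Hu.
  have := HM k; rewrite /graph_norm => H.
  have M0 : 0 <= M by exact: le_trans H.
  move: H; rewrite -ler_sqr ?nnegrE// sqr_sqrtr ?addr_ge0 ?sqr_ge0// !L2_normE//.
  have : 0 <= L2_dot oOmega (u k) (u k) by exact: inner_ge0.
  have : 0 <= L2_dot oOmega (laplacian oOmega (u k)) (laplacian oOmega (u k)) by exact: inner_ge0.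
  by move: (L2_dot _ _ _) (L2_dot _ _ _) => a b; lra.
case: N => [|N] in Omega oOmega cOmega neOmega bOmega u uH HM Lu OB OC fmu cauchy dM *.
  (* In dimension 0 every square integrable function is harmonic. *)
  have u0 k : L2_norm oOmega (u k) = 0.
    apply/eqP; rewrite -sqrf_eq0 L2_normE//; apply/eqP.
    have [_ [_]] := uH k; apply; split => // psi _.
    by congr Rintegral; apply/funext => x; rewrite /classical_laplacian big_ord0 mulr0 mul0r.
  exists id; split => //; exists 0; first by apply/L2_sqint; exact: sqint0.
  by under eq_fun do rewrite subr0 u0; exact: cvg_cst.
(* The dimension is now positive, and [ord0] serves as the direction of the Poincare inequality. *)
have [U [UU Uoo]] := ultraFilterLemma (eventually_filter : ProperFilter \oo).
have [s hs cs] := ultra_extract UU Uoo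
  (H_laplacian_tilde_cauchy B0 OB ord0 UU Uoo uH (fun k => (dM k).1) (fun k => (dM k).2)).
exact: cauchy hs cs.
Qed.
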